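(* Let $X$ be a two-dimensional complex torus and let $f:X\to X$ be a non-zero endomorphism. Then the fixed-points function $n\mapsto \#\mathrm{Fix}(f^n)$ has one of the following three behaviours: (B1) It grows exponentially in $n$, i.e., there are real constants $A,B>1$ and an integer $N$ such that for all $n\ge N$, $$A^n\le \#\mathrm{Fix}(f^n)\le B^n.$$ In this case both eigenvalues of $f$ (i.e., of its analytic representation $\rho_a(f)\in M_2(\mathbb{C})$) are of absolute value $\neq 1$. (B2) It is a periodic function. In this case the non-zero eigenvalues of $f$ are roots of unity, and they are contained in the set of $k$-th roots of unity where $k\in\{1,2,3,4,5,6,8,10,12\}$. (B3) It is of the form $$\#\mathrm{Fix}(f^n)=\begin{cases}0, & \text{if } n\equiv 0 \pmod r,\\ h(n), & \text{otherwise,}\end{cases}$$ where $r\ge 2$ is an integer and $h$ is an exponentially growing function. In this case one of the eigenvalues of $f$ is of absolute value $>1$ and the other is a root of unity. All three behaviours occur already in the projective case, i.e., on abelian surfaces.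
   Context: An endomorphism of a complex torus is a holomorphic group homomorphism from the torus to itself. For a complex torus $X=V/\Lambda$ of dimension $g$ (with $V\cong\mathbb{C}^g$ and $\Lambda\subset V$ a lattice), the analytic representation $\rho_a(f)\in M_g(\mathbb{C})$ of an endomorphism $f$ is the matrix of the $\mathbb{C}$-linear map $V\to V$ inducing $f$; the eigenvalues of $f$ are the eigenvalues of $\rho_a(f)$, counted with algebraic multiplicities. For an integer $n\ge 1$, $f^n=f\circ\cdots\circ f$ denotes the $n$-th iterate of $f$. $\#\mathrm{Fix}(f)$ denotes the number of fixed points of $f$, with the convention $\#\mathrm{Fix}(f)=0$ if the set of fixed points is infinite. The exponential growth of the function $h$ in (B3) is meant in the same sense as in (B1). An abelian surface is a projective two-dimensional complex torus.
   Formalization: In (B2) the formal theorem also allows one eigenvalue equal to 1 and the other of absolute value > 1: for f(x,y)=(x,2y) on E×E every #Fix(f^n) is 0, hence periodic, though the eigenvalue 2 is not a root of unity. *)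

(* Defs.v *)
From HB Require Import structures.
From mathcomp Require Import all_boot all_order all_algebra.
From mathcomp Require Import generic_quotient ring_quotient finmap.
From mathcomp Require Import complex ring.
From mathcomp Require Import all_classical all_reals all_analysis.

Set Implicit Arguments.
Unset Strict Implicit.
Unset Printing Implicit Defensive.

Import Order.TTheory GRing.Theory Num.Theory.
Import numFieldNormedType.Exports.

Local Open Scope classical_set_scope.
Local Open Scope ring_scope.
Local Open Scope complex_scope.
Local Open Scope quotient_scope.

(* The norm topology on R[i], which real-closed's complex numbers lack; it is
   what makes spaces of complex matrices normed modules over R[i]. *)
Section ComplexTopology.
Variable R : realType.

HB.instance Definition _ := PseudoPointedMetric.copy R[i] R[i]^o.
HB.instance Definition _ := GRing.ComAlgebra.copy R[i] R[i]^o.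
HB.instance Definition _ := Vector.copy R[i] R[i]^o.
HB.instance Definition _ := NormedModule.copy R[i] R[i]^o.

End ComplexTopology.

Section ComplexTori.
Variable R : realType.
Notation C := R[i].
Notation V := 'cV[C]_2.

Definition real_free (b : 'I_4 -> V) : Prop :=
  forall c : 'I_4 -> R, \sum_i (c i)%:C *: b i = 0 -> forall i, c i = 0.

Definition integer_span (b : 'I_4 -> V) : set V :=
  [set v | exists m : 'I_4 -> int, v = \sum_i b i *~ m i].

(* The two-dimensional complex torus V / lattice, in coordinates V = C^2.  As
   V has real dimension 4, a real_free family of four vectors is a real basis
   of V. *)
Record complex_torus := ComplexTorus {
  lattice : set V;
  latticeP : exists2 b, real_free b & lattice = integer_span b
}.

Definition mem_lattice (X : complex_torus) (v : V) : bool := `[< lattice X v >].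

Lemma mem_lattice_zmod_closed X : zmod_closed (mem_lattice X).
Proof.
have [b _ e] := latticeP X.
split; first by apply/asboolP; rewrite e; exists (fun=> 0); rewrite big1.
move=> u v /asboolP; rewrite e => -[m ->] /asboolP; rewrite e => -[m' ->].
apply/asboolP; rewrite e; exists (fun i => m i - m' i).
by rewrite -sumrB; apply: eq_bigr => i _; rewrite mulrzBr.
Qed.

HB.instance Definition _ X :=
  GRing.isZmodClosed.Build V (mem_lattice X) (mem_lattice_zmod_closed X).

Definition points (X : complex_torus) :=
  @ring_quotient.Quotient.quot V (GRing.ZmodClosed.clone _ (mem_lattice X) _).

HB.instance Definition _ X := GRing.Zmodule.on (points X).
HB.instance Definition _ X := ZmodQuotient.on (points X).

Coercion points : complex_torus >-> Sortclass.

Definition torus_proj (X : complex_torus) (v : V) : X := \pi_(points X) v.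

Lemma torus_projE (X : complex_torus) (u v : V) :
  (torus_proj X u = torus_proj X v) <-> lattice X (u - v).
Proof.
have H := @ring_quotient.Quotient.idealrBE V
  (GRing.ZmodClosed.clone _ (mem_lattice X) _) u v.
split; first by move=> /eqP; rewrite /torus_proj /points -H => /asboolP.
by move=> /asboolP h; apply/eqP; rewrite /torus_proj /points -H.
Qed.

Lemma torus_projB (X : complex_torus) : {morph torus_proj X : u v / u - v}.
Proof. by move=> u v; rewrite /torus_proj raddfB. Qed.

Lemma torus_projMn (X : complex_torus) n : {morph torus_proj X : u / u *+ n}.
Proof. by move=> u; rewrite /torus_proj raddfMn. Qed.

Lemma entry_le_norm (v : V) i : `|v i 0| <= `|v|.
Proof.
rewrite {2}/Num.norm /= mx_normE -[leLHS]nngE num_le.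
exact: (le_bigmax _ (fun ij : 'I_2 * 'I_1 => `|v ij.1 ij.2|%:nng) (i, 0)).
Qed.

Lemma lattice_discrete (X : complex_torus) :
  exists2 e : C, 0 < e & forall v, lattice X v -> `|v| < e -> v = 0.
Proof.
have [b bf e] := latticeP X.
pose r (v : V) : 'rV[R]_4 := \row_j
  (if (j < 2)%N then complex.Re (v (inord j) 0)
   else complex.Im (v (inord (j - 2)) 0)).
have rB : zmod_morphism r.
  move=> u v; apply/rowP => j; rewrite !mxE; case: ifP => _;
    by case: (u _ _) => ? ?; case: (v _ _).
pose rA : {additive V -> 'rV[R]_4} := HB.pack r (GRing.isZmodMorphism.Build _ _ r rB).
pose B : 'M[R]_4 := \matrix_i r (b i).
have Bf : row_free B.
  apply/inj_row_free => c cB; apply/rowP => i; rewrite !mxE.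
  apply: (bf (fun i => c 0 i)); apply/colP => k.
  rewrite summxE mxE.
  have key j : \sum_i c 0 i * r (b i) 0 j = 0.
    move/rowP/(_ j): cB; rewrite !mxE => h; rewrite -[RHS]h.
    by apply: eq_bigr => x _; rewrite [B _ _]mxE.
  apply/eqP; rewrite eq_complex !raddf_sum /=; apply/andP; split; apply/eqP.
    rewrite -[RHS](key (inord k)); apply: eq_bigr => x _.
    rewrite !mxE /= inordK; last by apply: leq_trans (ltn_ord k) _.
    by rewrite ltn_ord inord_val; case: (b x k 0) => ? ? /=; rewrite mul0r subr0.
  rewrite -[RHS](key (inord (k + 2))); apply: eq_bigr => x _.
  rewrite !mxE /= inordK; last by rewrite -[4%N]/(2 + 2)%N ltn_add2r.
  rewrite ltnNge leq_addl /= addnK inord_val; case: (b x k 0) => ? ? /=.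
  by rewrite mul0r addr0.
have Bu : B \in unitmx by rewrite -row_free_unit.
pose K : R := 1 + \sum_i \sum_j `|invmx B i j|.
have Kgt0 : 0 < K.
  by rewrite ltr_wpDr // sumr_ge0 // => i _; rewrite sumr_ge0.
have rle v k : (`|r v 0 k|)%:C <= `|v|.
  have H i z : z = complex.Re (v i 0) \/ z = complex.Im (v i 0) -> `|z|%:C <= `|v|.
    move=> h; apply: le_trans (entry_le_norm v i); case: h => ->.
      exact: normc_ge_Re.
    rewrite normc_def lecR -sqrtr_sqr ler_wsqrtr // lerDr sqr_ge0 //.
  apply: (H (if (k < 2)%N then inord k else inord (k - 2))); rewrite mxE.
  by case: ifP => _; [left|right].
exists (K^-1)%:C; first by rewrite ltcR invr_gt0.
move=> v; rewrite e => -[m mv] vlt.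
suff m0 i : m i = 0 by rewrite mv big1 // => i _; rewrite m0 mulr0z.
have mE : \row_i (m i)%:~R = r v *m invmx B.
  apply: (canRL (mulmxK Bu)); rewrite mv -[r _]/(rA _) raddf_sum.
  apply/rowP => j; rewrite !mxE summxE; apply: eq_bigr => k _.
  by rewrite raddfMz /= -scaler_int !mxE.
suff: `|(m i)%:~R : R| < 1 by rewrite -intr_norm ltrz1; case: (m i) => [[]|].
have -> : (m i)%:~R = (r v *m invmx B) 0 i by rewrite -mE mxE.
rewrite mxE; apply: (le_lt_trans (ler_norm_sum _ _ _)).
have rlt k : `|r v 0 k| <= K^-1.
  by rewrite -lecR; apply: le_trans (rle v k) (ltW vlt).
apply: (@le_lt_trans _ _ (K^-1 * \sum_j `|invmx B j i|)).
  rewrite mulr_sumr; apply: ler_sum => k _; rewrite normrM.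
  by rewrite ler_wpM2r.
rewrite mulrC ltr_pdivrMr // mul1r /K.
rewrite -[ltLHS]add0r ltr_leD //; apply: ler_sum => j _.
by rewrite (bigD1 i) //= lerDl sumr_ge0.
Qed.

Lemma pow2_small (e : C) (x : C) : 0 < e -> 0 <= x -> exists k, x / 2 ^+ k < e.
Proof.
move=> e0 x0.
have xE : x = (complex.Re x)%:C by rewrite RRe_real // ger0_real.
have eE : e = (complex.Re e)%:C by rewrite RRe_real // gtr0_real.
move: e0 x0; rewrite xE eE ltcR lecR => e0 x0.
have [k hk] : exists k : nat, complex.Re x / complex.Re e < k%:R.
  exists (Num.bound (complex.Re x / complex.Re e)); apply: archi_boundP.
  by rewrite divr_ge0 // ltW.
exists k.
have -> : (2 : C) ^+ k = (2 ^+ k)%:C by rewrite rmorphXn rmorph_nat.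
rewrite -fmorphV -rmorphM ltcR ltr_pdivrMr ?exprn_gt0 //.
rewrite mulrC -ltr_pdivrMr //; apply: lt_trans hk _.
by rewrite -natrX ltr_nat ltn_expl.
Qed.

(* The charts of X are the local inverses of torus_proj, so f is holomorphic
   when f \o torus_proj locally lifts to a complex-differentiable map. *)
Definition holomorphic (X : complex_torus) (f : X -> X) : Prop :=
  forall v : V, exists F : V -> V, \forall w \near v,
    differentiable F w /\ f (torus_proj X w) = torus_proj X (F w).

Definition is_analytic_rep (X : complex_torus) (f : X -> X) (M : 'M[C]_2) : Prop :=
  forall v : V, f (torus_proj X v) = torus_proj X (M *m v).

Lemma analytic_rep_uniq (X : complex_torus) (f : X -> X) M M' :
  is_analytic_rep f M -> is_analytic_rep f M' -> M = M'.
Proof.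
move=> fM fM'; have [e e0 eL] := lattice_discrete X.
suff H (v : V) : (M - M') *m v = 0.
  apply/eqP; rewrite -subr_eq0; apply/eqP/matrixP => i j.
  have := H (delta_mx j 0); move/colP/(_ i); rewrite !mxE.
  rewrite (bigD1 j) //= big1 => [|k kj]; rewrite !mxE ?eqxx ?mulr1 ?addr0 //.
  by rewrite (negbTE kj) mulr0.
have [k hk] := pow2_small e0 (normr_ge0 ((M - M') *m v)).
pose w := ((2 : C) ^+ k)^-1 *: v.
have p2 : (2 : C) ^+ k != 0 by rewrite expf_neq0 // pnatr_eq0.
have -> : v = 2 ^+ k *: w by rewrite scalerA divff // scale1r.
rewrite -scalemxAr (_ : (M - M') *m w = 0) ?scaler0 //.
apply: eL; first by rewrite mulmxBl; apply/torus_projE; rewrite -fM -fM'.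
rewrite /w -scalemxAr normrZ ger0_norm; first by rewrite mulrC.
by rewrite invr_ge0 exprn_ge0.
Qed.

Lemma analytic_rep_exists (X : complex_torus) (f : {additive X -> X}) :
  holomorphic f -> exists M, is_analytic_rep f M.
Proof.
move=> hf; have [e e0 eL] := lattice_discrete X.
have [F Fn] := hf 0.
have [dF0 fF0] := nbhs_singleton Fn.
have pi0 : torus_proj X 0 = 0 by rewrite /torus_proj raddf0.
have piF0 : torus_proj X (F 0) = 0 by rewrite -fF0 pi0 raddf0.
pose G w := F w - F 0.
have fG : \forall w \near (0 : V), f (torus_proj X w) = torus_proj X (G w).
  by apply: filterS Fn => w [_ ->]; rewrite torus_projB piF0 subr0.
pose h : C := 2^-1.
have half : continuous (fun w : V => h *: w) by exact: scaler_continuous.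
have n_half (P : set V) : (\forall w \near (0 : V), P w) ->
    \forall w \near (0 : V), P (h *: w).
  move=> Pn; have := half 0; rewrite /continuous_at scaler0 => /(_ P Pn); exact.
have w2 (w : V) : w = (h *: w) *+ 2.
  by rewrite -scaler_nat scalerA mulfV ?pnatr_eq0 // scale1r.
have Gc : {for 0, continuous G}.
  apply: continuousB; [exact: differentiable_continuous|exact: cst_continuous].
have G0 : G 0 = 0 by rewrite /G subrr.
pose D w := G w - (G (h *: w)) *+ 2.
have DL : \forall w \near (0 : V), lattice X (D w).
  near=> w; apply/torus_projE; rewrite torus_projMn.
  have <- : f (torus_proj X w) = torus_proj X (G w) by near: w.
  have <- : f (torus_proj X (h *: w)) = torus_proj X (G (h *: w)).
    by near: w; exact: n_half fG.
  by rewrite -raddfMn -torus_projMn -w2.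
have Gsmall (d : C) : 0 < d -> \forall w \near (0 : V), `|G w| < d.
  move=> d0; have Gc' : G @ (0 : V) --> (0 : V).
    by rewrite -[X in _ --> X]G0; exact: Gc.
  move/cvgr0Pnorm_lt: Gc' => /(_ d d0); exact.
have De : \forall w \near (0 : V), `|D w| < e.
  have e3 : 0 < e / 3 by rewrite divr_gt0.
  have g1 := Gsmall _ e3; have g2 := n_half _ g1.
  near=> w; apply: le_lt_trans (ler_normB _ _) _.
  have -> : e = e / 3 + (e / 3) *+ 2 by field.
  apply: ltrD; first by near: w.
  rewrite normrMn ltr_wMn2r //.
  by near: w.
have D0 : \forall w \near (0 : V), D w = 0.
  near=> w; apply: eL; by near: w.
have [d /= d0 dD] : exists2 d : C, 0 < d & forall w, `|w| < d -> D w = 0 /\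
    f (torus_proj X w) = torus_proj X (G w).
  have /nbhs_norm0P[d d0 dP] : \forall w \near (0 : V), D w = 0 /\
    f (torus_proj X w) = torus_proj X (G w) by near=> w; split; near: w.
  by exists d => // w wd; apply: dP.
have h0 : 0 < h by rewrite invr_gt0.
have h1 : h <= 1 by rewrite invf_le1 ?ler1n.
have hk0 k : 0 <= h ^+ k by rewrite exprn_ge0 ?ltW.
have hk1 k : h ^+ k <= 1 by apply: exprn_ile1; [exact: ltW|].
have hkd k (w : V) : `|w| < d -> `|h ^+ k *: w| < d.
  move=> wd; rewrite normrZ ger0_norm //; apply: le_lt_trans wd.
  by rewrite ler_piMl.
have p2 k : (h ^+ k) * 2 ^+ k = 1.
  by rewrite -exprMn mulVf ?expr1n // pnatr_eq0.
have Gk k (w : V) : `|w| < d -> G w = 2 ^+ k *: G (h ^+ k *: w).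
  move=> wd; elim: k => [|k ->]; first by rewrite !expr0 !scale1r.
  have [Dk _] := dD _ (hkd k w wd).
  move: Dk; rewrite /D scalerA -exprS => /subr0_eq ->.
  by rewrite -[G _ *+ 2]scaler_nat scalerA -exprSr.
pose L : {linear V -> V} := 'd F 0.
have GL (w : V) : `|w| < d -> G w = L w.
  move=> wd; apply/eqP; rewrite -subr_eq0 -normr_eq0; apply/negPn/negP => nz.
  have nn : 0 < `|G w - L w| by rewrite lt_def nz normr_ge0.
  have w0 : 0 < `|w|.
    rewrite normr_gt0; apply: contraNneq nz => ->.
    by rewrite G0 linear0 subrr normr0.
  pose c := `|G w - L w| / `|w| / 2.
  have c0 : 0 < c by rewrite !divr_gt0.
  have : \forall u \near (0 : V), `|G u - L u| <= c * `|u|.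
    have /diff_locally /eqaddoP /(_ c c0) := dF0.
    apply: filterS => u; apply: le_trans; rewrite le_eqVlt; apply/orP; left.
    apply/eqP; congr (`| _ |); rewrite /G /L !fctE /= addr0.
    by rewrite opprD addrA.
  move=> /nbhs_norm0P[r /= r0 rP].
  have [k hk] := pow2_small r0 (normr_ge0 w).
  have hkE : h ^+ k = (2 ^+ k)^-1 by rewrite exprVn.
  have : `|h ^+ k *: w| < r by rewrite normrZ ger0_norm // hkE mulrC.
  move=> /rP /=.
  have -> : G (h ^+ k *: w) - L (h ^+ k *: w) = h ^+ k *: (G w - L w).
    by rewrite linearZ /= scalerBr (Gk k w wd) scalerA p2 scale1r.
  rewrite !normrZ mulrCA ler_pM2l; last first.
    by rewrite normr_gt0 hkE invr_eq0 expf_neq0 // pnatr_eq0.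
  rewrite /c mulrAC divfK ?gt_eqF // => hle.
  move: hle; rewrite ler_pdivlMr ?ltr0n // mulr_natr mulr2n gerDl.
  by rewrite lt_geF.
pose M : 'M[C]_2 := \matrix_(i, j) L (delta_mx j 0) i 0.
have LM v : L v = M *m v.
  have vE : v = \sum_j v j 0 *: delta_mx j 0.
    apply/colP => i; rewrite summxE (bigD1 i) //= big1 ?addr0 ?mxE ?eqxx ?mulr1 //.
    by move=> j ji; rewrite !mxE eq_sym (negbTE ji) mulr0.
  rewrite [in LHS]vE linear_sum; apply/colP => i; rewrite summxE mxE.
  by apply: eq_bigr => j _; rewrite linearZ !mxE mulrC.
exists M => v.
have [k hk] := pow2_small d0 (normr_ge0 v).
have wd : `|h ^+ k *: v| < d by rewrite normrZ ger0_norm // mulrC exprVn.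
have vE : v = (h ^+ k *: v) *+ 2 ^ k.
  by rewrite -scaler_nat natrX scalerA mulrC p2 scale1r.
rewrite [in LHS]vE torus_projMn raddfMn /= (dD _ wd).2 GL // LM -torus_projMn.
by rewrite -raddfMn /= -vE.
Unshelve. all: by end_near.
Qed.

Definition rho_a (X : complex_torus) (f : X -> X) : 'M[C]_2 :=
  get [set M : 'M[C]_2 | is_analytic_rep f M].

Lemma rho_aP (X : complex_torus) (f : {additive X -> X}) (M : 'M[C]_2) :
  holomorphic f -> is_analytic_rep f M <-> M = rho_a f.
Proof.
move=> hf; have [M0 fM0] := analytic_rep_exists hf.
have fR : is_analytic_rep f (rho_a f).
  by apply: (@getPex _ [set M | is_analytic_rep f M]); exists M0.
by split => [fM|->//]; exact: analytic_rep_uniq fM fR.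
Qed.

Definition eigenvalues (X : complex_torus) (f : X -> X) (l1 l2 : C) : Prop :=
  char_poly (rho_a f) = ('X - l1%:P) * ('X - l2%:P).

(* fset_set A is empty when A is infinite, so nfix f = 0 in that case. *)
Definition nfix (X : complex_torus) (f : X -> X) : nat :=
  #|` fset_set [set x : X | f x = x] |.

Definition line (N : nat) (z : 'rV[C]_N.+1) : set 'rV[C]_N.+1 :=
  [set c *: z | c in [set: C]].

(* phi is an injective holomorphic immersion of X into P^N, i.e. (X being
   compact) a holomorphic embedding.  Points of P^N are lines in C^(N+1), a
   holomorphic map to P^N is locally [F] with F holomorphic and nowhere zero,
   and the kernel of the differential of [F] at v consists of the u such that
   'd F v u lies in the line of F v. *)
Definition projective (X : complex_torus) : Prop :=
  exists (N : nat) (phi : X -> set 'rV[C]_N.+1),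
    injective phi /\
    forall v : V, exists F : V -> 'rV[C]_N.+1,
      (\forall w \near v, [/\ differentiable F w, F w != 0 &
          phi (torus_proj X w) = line (F w)]) /\
      (forall u : V, line (F v) ('d F v u) -> u = 0).

End ComplexTori.

Definition exp_growth (R : realType) (u : nat -> nat) : Prop :=
  exists A B : R, [/\ 1 < A, 1 < B &
    exists N : nat, forall n : nat, (N <= n)%N ->
      A ^+ n <= (u n)%:R /\ (u n)%:R <= B ^+ n].

(* Only the iterates f^n with n >= 1 count: if f \o f = 0, then f^n has one
   fixed point for every n >= 1, whereas nfix is 0 at f^0 = id. *)
Definition periodic_sequence (u : nat -> nat) : Prop :=
  exists2 p : nat, (0 < p)%N & forall n : nat, (0 < n)%N -> u (n + p)%N = u n.

Definition exp_growth_off_multiples (R : realType) (u : nat -> nat) : Prop :=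
  exists (r : nat) (h : nat -> nat), [/\ (2 <= r)%N, exp_growth R h &
    forall n : nat, (0 < n)%N -> u n = if (r %| n)%N then 0%N else h n].

Definition is_root_of_unity (R : realType) (l : R[i]) : Prop :=
  exists2 m : nat, (0 < m)%N & m.-unity_root l.

(* Main.v *)
Require Import Defs.
From HB Require Import structures.
From mathcomp Require Import all_boot all_order all_algebra.
From mathcomp Require Import generic_quotient ring_quotient finmap.
From mathcomp Require Import complex ring lra zify.
From mathcomp Require Import all_classical all_reals all_analysis.

(** Why the theorem holds.

    Counting.  Let M be the analytic representation of f, A the integral 4 x 4
    matrix of f on a basis of the lattice, and c in R^4 the coordinates of a
    point.  A point is fixed by f^n exactly when (A^n - 1) c is integral.  The
    Smith normal form of A^n - 1 decouples these equations, so there are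
    |det (A^n - 1)| fixed points, or infinitely many when the determinant
    vanishes; with the convention for infinite sets the formula
    |det (A^n - 1)| is always right ([nfix_Smith]).  Over C the matrix A is
    conjugate to the block sum of M and its complex conjugate, hence
      nfix (f^n) = |l1^n - 1|^2 |l2^n - 1|^2    ([nfix_iter])
    and the quartic with roots l1, l2 and their conjugates has integral
    coefficients ([eigenvalues_integrality]).

    Classification.  Put t_i = 2 Re l_i and n_i = |l_i|^2.  The quartic is
    (X^2 - t1 X + n1)(X^2 - t2 X + n2), which makes t1 + t2, t1 t2 + n1 + n2,
    t1 n2 + t2 n1 and n1 n2 integers.  If n1 = 1 and n2 <> 1, then t1 is
    rational, because (n2 - 1) t1 is an integer, and it is a root of a monic
    integral quadratic polynomial, so it is an integer; as |t1| <= 2, the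
    eigenvalue l1 is a root of unity of order 1, 2, 3, 4 or 6.  If n1 = n2 = 1,
    then t1 and t2 are the roots in [-2, 2] of an integral polynomial
    Y^2 - a Y + p, which leaves 19 pairs (a, p), and for each of them the
    orders of l1 and l2 can be read off.  If n1, n2 < 1, then the integer
    n1 n2 is 0, so one eigenvalue vanishes; then n1 + n2 is an integer too, and
    it is 0.  This is [classify_eigenvalues].  In each case
    the product formula decides between exponential growth, periodicity and
    growth off the multiples of the order of a root of unity, and these
    behaviours exclude each other ([eigenvalue_behaviour]).

    Examples.  All three live on E x E for E = C / omega Z[i], so the work is
    to embed this torus in a projective space.  The amplitude am is the inverse
    function of the elliptic integral of 1 / sqrt (1 - sin^2 / 2); it yields real
    Jacobi functions s, c, d of modulus k^2 = 1/2 ([real_jacobi_exists]).  Jacobi's imaginary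
    transformation and addition formulas express sn, cn and dn at x + i y
    rationally in the values of s, c, d at x and at y; taken as definitions,
    they are holomorphic by the Cauchy-Riemann equations.  At the common poles
    the coordinates (sn : cn : dn : 1) are replaced by the proportional
    (1 : cs : ds : ns).  The resulting map E -> P^3 is an immersion because the
    derivatives cn dn, - sn dn, - sn cn / 2 have no common zero, and it is
    injective because 1 + |sn|^2 + |cn|^2 is twice the inverse of the common
    denominator, after which s, c at x and at y can be recovered one by one.
    The Segre map embeds E x E in P^15 ([square_torus_projective]).  The
    endomorphisms (2, 2), (1, 1) and (-1, 2) show the three behaviours. *)

Set Implicit Arguments.
Unset Strict Implicit.
Unset Printing Implicit Defensive.

Import Order.TTheory GRing.Theory Num.Theory.
Import numFieldNormedType.Exports.
Local Open Scope ring_scope.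

Local Notation Re := (@complex.Re _).
Local Notation Im := (@complex.Im _).

(** * The period matrix of a torus *)

Section PeriodMatrix.
Local Open Scope classical_set_scope.
Local Open Scope complex_scope.
Variables (R : realType) (X : complex_torus R) (b : 'I_4 -> 'cV[R[i]]_2).
Hypothesis b_free : real_free b.
Hypothesis latticeE : lattice X = integer_span b.
Local Notation C := R[i].
Local Notation V := 'cV[C]_2.
Local Notation real_mx := (map_mx (real_complex R)).
Local Notation int_mx := (map_mx (intr : int -> R)).

Definition period_mx : 'M[C]_(2, 4) := \matrix_(k, i) b i k 0.

Lemma period_mxE (a : 'cV[C]_4) : period_mx *m a = \sum_i a i 0 *: b i.
Proof.
apply/colP => k; rewrite mxE summxE; apply: eq_bigr => i _.
by rewrite !mxE mulrC.
Qed.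

Lemma period_mx_inj (c : 'cV[R]_4) : period_mx *m real_mx c = 0 -> c = 0.
Proof.
rewrite period_mxE => e; apply/colP => i; rewrite mxE.
by apply: (b_free (c := fun i => c i 0)); rewrite -[RHS]e; apply: eq_bigr => j _; rewrite mxE.
Qed.

Lemma mem_latticeE v :
  lattice X v <-> exists m : 'cV[int]_4, v = period_mx *m real_mx (int_mx m).
Proof.
rewrite latticeE; split=> [[m ->]|[m ->]].
  exists (\col_i m i); rewrite period_mxE; apply: eq_bigr => i _.
  by rewrite !mxE -scaler_int rmorph_int.
exists (fun i => m i 0); rewrite period_mxE; apply: eq_bigr => i _.
by rewrite !mxE -[in RHS]scaler_int rmorph_int.
Qed.

(** Stacking the period matrix on its conjugate makes it square.  Intertwined
    by this matrix, the rational representation becomes the sum of the analytic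
    one and its conjugate. *)
Definition full_period_mx : 'M[C]_(2 + 2, 4) :=
  col_mx period_mx (map_mx conjc period_mx).

Lemma map_conjcK m n (A : 'M[C]_(m, n)) : map_mx conjc (map_mx conjc A) = A.
Proof. by apply/matrixP => i j; rewrite !mxE conjcK. Qed.

(** If the period matrix and its conjugate both kill x, then the period matrix
    kills the real and the imaginary part of x, which are real relations between
    the periods. *)
Lemma full_period_kernel (x : 'cV[C]_4) : full_period_mx *m x = 0 -> x = 0.
Proof.
move=> /eqP; rewrite mul_col_mx col_mx_eq0 => /andP[/eqP e1 /eqP e2].
have e3 : period_mx *m map_mx conjc x = 0.
  have := congr1 (map_mx conjc) e2; by rewrite map_mxM map_mx0 map_conjcK.
pose re : 'cV[R]_4 := \col_i complex.Re (x i 0).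
pose im : 'cV[R]_4 := \col_i complex.Im (x i 0).
have two0 : (2 : C) != 0 by rewrite pnatr_eq0.
have reE : 2 *: real_mx re = x + map_mx conjc x.
  apply/colP => i; rewrite !mxE; case: (x i 0) => u v.
  by apply/eqP; rewrite eq_complex /=; apply/andP; split; apply/eqP; ring.
have imE : (2 * 'i) *: real_mx im = x - map_mx conjc x.
  apply/colP => i; rewrite !mxE; case: (x i 0) => u v.
  by apply/eqP; rewrite eq_complex /=; apply/andP; split; apply/eqP; ring.
have re0 : re = 0.
  apply: period_mx_inj; apply: (scalerI two0).
  by rewrite scalemxAr reE mulmxDr e1 e3 addr0 scaler0.
have im0 : im = 0.
  have i0 : 2 * 'i != 0 :> C by rewrite mulf_neq0 // eq_complex /= oner_eq0 andbF.
  apply: period_mx_inj; apply: (scalerI i0).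
  by rewrite scalemxAr imE mulmxBr e1 e3 subr0 scaler0.
apply/colP => i; move/colP/(_ i): re0; move/colP/(_ i): im0; rewrite !mxE.
by case: (x i 0) => u v /= -> ->.
Qed.

Lemma full_period_unit : (full_period_mx : 'M[C]_4) \in unitmx.
Proof.
rewrite -unitmx_tr -row_free_unit; apply: inj_row_free => r h.
apply: trmx_inj; rewrite trmx0; apply: full_period_kernel.
by apply: trmx_inj; rewrite trmx_mul trmxK h trmx0.
Qed.

(** The coordinates of v are the solution of the square system with right-hand
    side v stacked on its conjugate.  Conjugation swaps the two halves of the
    system, so the solution is real. *)
Lemma period_mx_surj (v : V) : exists c : 'cV[R]_4, v = period_mx *m real_mx c.
Proof.
pose x : 'cV[C]_4 := invmx (full_period_mx : 'M[C]_4) *m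
  (col_mx v (map_mx conjc v) : 'cV[C]_(2 + 2)).
have Px : full_period_mx *m x = col_mx v (map_mx conjc v).
  exact: (mulKVmx full_period_unit).
clearbody x.
have [e1 e2] : period_mx *m x = v /\ map_mx conjc period_mx *m x = map_mx conjc v.
  by move: Px; rewrite mul_col_mx => /eq_col_mx.
have xr : map_mx conjc x = x.
  apply/eqP; rewrite -subr_eq0; apply/eqP; apply: full_period_kernel.
  have e1' := congr1 (map_mx conjc) e1; have e2' := congr1 (map_mx conjc) e2.
  rewrite map_mxM !map_conjcK in e2'.
  rewrite map_mxM in e1'.
  by rewrite mulmxBr !mul_col_mx e1 e2 e2' e1' subrr.
exists (\col_i complex.Re (x i 0)); rewrite -[LHS]e1; congr (_ *m _).
apply/colP => i; rewrite !mxE; move/colP/(_ i): xr; rewrite mxE.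
by case: (x i 0) => u w [/eqP]; rewrite eq_sym -subr_eq0 opprK -mulr2n mulrn_eq0 /= => /eqP ->.
Qed.
End PeriodMatrix.

(** * Fixed points and the Smith normal form *)

Section IntegerVectors.
Local Open Scope classical_set_scope.
Local Open Scope complex_scope.
Variable R : realType.
Local Notation int_mx := (map_mx (intr : int -> R)).

Definition integral_col (c : 'cV[R]_4) := exists m : 'cV[int]_4, c = int_mx m.

Lemma integral_colP c : integral_col c <-> forall i, exists z : int, c i 0 = z%:~R.
Proof.
split=> [[m ->] i|h]; first by exists (m i 0); rewrite mxE.
exists (\col_i projT1 (cid (h i))); apply/colP => i; rewrite !mxE.
by case: cid.
Qed.

Lemma integral_colM (A : 'M[int]_4) c : integral_col c -> integral_col (int_mx A *m c).
Proof. by move=> [m ->]; exists (A *m m); rewrite map_mxM. Qed.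

Lemma integral_col_unit (A : 'M[int]_4) c : A \in unitmx ->
  integral_col (int_mx A *m c) <-> integral_col c.
Proof.
move=> uA; split; last exact: integral_colM.
by move=> /(integral_colM (invmx A)); rewrite mulmxA -map_mxM mulVmx // map_mx1 mul1mx.
Qed.

(** Together with the next lemma: the solutions of d t = 0 in R / Z are
    represented once each by k / d for 0 <= k < |d|. *)
Lemma torsion_point_repr (d : int) (t : R) (z : int) : d != 0 -> d%:~R * t = z%:~R ->
  (`|(z %% d)%Z| < `|d|)%N /\
  exists q : int, t - `|(z %% d)%Z|%N%:R / d%:~R = q%:~R.
Proof.
move=> d0 e; have dR : d%:~R != 0 :> R by rewrite intr_eq0.
have z0 := modz_ge0 z d0; split.
  by rewrite -ltz_nat gez0_abs // abszE ltz_mod.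
exists (z %/ d)%Z; rewrite pmulrn gez0_abs //.
apply: (mulfI dR); rewrite mulrBr e mulrCA mulfV // mulr1.
by rewrite -intrM -intrB mulrC {1}(divz_eq z d) addrK.
Qed.

Lemma torsion_point_inj (d : int) (k l : nat) (q : int) : d != 0 ->
  (k < `|d|)%N -> (l < `|d|)%N -> k%:R / d%:~R - l%:R / d%:~R = q%:~R :> R -> k = l.
Proof.
move=> d0 kd ld; rewrite -mulrBl; move=> /(canRL (divfK _)).
rewrite intr_eq0 => /(_ d0) /eqP; rewrite !pmulrn -intrB -intrM eqr_int => /eqP e.
have : (d %| k%:Z - l%:Z)%Z by rewrite e dvdz_mull.
have [->//|ne] := eqVneq k l; move=> /dvdzP[c ec].
have c0 : c != 0 by apply: contra_neq ne => c0; move: ec; rewrite c0; lia.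
nia.
Qed.
End IntegerVectors.

Section FixedPoints.
Local Open Scope classical_set_scope.
Local Open Scope complex_scope.
Variables (R : realType) (X : complex_torus R) (b : 'I_4 -> 'cV[R[i]]_2).
Hypothesis b_free : real_free b.
Hypothesis latticeE : lattice X = integer_span b.
Local Notation C := R[i].
Local Notation V := 'cV[C]_2.
Local Notation real_mx := (map_mx (real_complex R)).
Local Notation int_mx := (map_mx (intr : int -> R)).
Local Notation Pi := (period_mx b).

Variables (g : X -> X) (M : 'M[C]_2) (A : 'M[int]_4).
Hypothesis gM : is_analytic_rep g M.
Hypothesis MA : M *m Pi = Pi *m real_mx (int_mx A).

Variables (L U : 'M[int]_4) (d : 'I_4 -> int).
Hypothesis L_unit : L \in unitmx.
Hypothesis U_unit : U \in unitmx.
Hypothesis Smith : A - 1%:M = L *m diag_mx (\row_i d i) *m U.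

(** Coordinates adapted to the Smith normal form: the change of basis U is
    unimodular, so these coordinates still identify X with R^4 / Z^4. *)
Definition point (e : 'cV[R]_4) : X :=
  torus_proj X (Pi *m real_mx (int_mx (invmx U) *m e)).

Lemma point_surj x : exists e, x = point e.
Proof.
have [c cE] := period_mx_surj b_free (repr x); exists (int_mx U *m c).
rewrite /point mulmxA -map_mxM mulVmx // map_mx1 mul1mx -cE.
by rewrite /torus_proj reprK.
Qed.

Lemma lattice_period (c : 'cV[R]_4) : lattice X (Pi *m real_mx c) <-> integral_col c.
Proof.
rewrite (mem_latticeE latticeE); split=> -[m e]; exists m; last by rewrite e.
apply/eqP; rewrite -subr_eq0; apply/eqP/(period_mx_inj b_free).
by rewrite map_mxB mulmxBr e subrr.
Qed.

Lemma point_eq e e' : point e = point e' <-> integral_col (e - e').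
Proof.
rewrite /point torus_projE -mulmxBr -map_mxB -mulmxBr lattice_period.
by apply: integral_col_unit; rewrite unitmx_inv.
Qed.

Lemma point_fixed e : g (point e) = point e <->
  forall i, exists z : int, (d i)%:~R * e i 0 = z%:~R.
Proof.
rewrite /point gM torus_projE mulmxA MA -mulmxA -map_mxM -mulmxBr -map_mxB.
rewrite lattice_period -{2}[int_mx (invmx U) *m e]mul1mx -mulmxBl.
rewrite -(map_mx1 (intr : {rmorphism int -> R})) -map_mxB Smith !map_mxM -!mulmxA.
rewrite [X in _ *m (_ *m X)]mulmxA -map_mxM mulmxV // map_mx1 mul1mx.
rewrite integral_col_unit // integral_colP.
have dE i : (int_mx (diag_mx (\row_i d i)) *m e) i 0 = (d i)%:~R * e i 0.
  rewrite map_diag_mx mxE (bigD1 i) //= big1 ?addr0; first by rewrite !mxE eqxx.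
  by move=> j ji; rewrite !mxE eq_sym (negbTE ji) mul0r.
by split=> h i; have := h i; rewrite dE.
Qed.

(** When d j = 0 the j-th coordinate of a fixed point is free; the values
    1 / (n + 2) are pairwise distinct modulo 1 and give infinitely many. *)
Lemma nfix_infinite j : d j = 0 -> nfix g = 0%N.
Proof.
move=> dj; rewrite /nfix /fset_set; case: pselect => // fin; exfalso.
pose f (n : nat) : X := point (\col_i (if i == j then n.+2%:R^-1 else 0)).
have f_inj : injective f.
  move=> n m /point_eq/integral_colP/(_ j)[z]; rewrite !mxE eqxx => e.
  have inv_lt1 k : 0 < (k.+2%:R : R)^-1 < 1.
    by rewrite invr_gt0 ltr0n invf_lt1 ?ltr0n // ltr1n.
  have /andP[n0 n1] := inv_lt1 n; have /andP[m0 m1] := inv_lt1 m.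
  have [z1 z2] : (z%:~R : R) < 1 /\ -1 < (z%:~R : R).
    rewrite -e; move: n0 n1 m0 m1; move: (n.+2%:R^-1) (m.+2%:R^-1) => x y *.
    by split; lra.
  have z0 : z = 0.
    move: z1 z2; rewrite -(rmorphN1 (intr : {rmorphism int -> R})) ltrz1 ltr_int.
    by lia.
  move: e; rewrite z0 => /eqP; rewrite subr_eq0 => /eqP/invr_inj/eqP.
  by rewrite eqr_nat => /eqP[].
have : finite_set (f @^-1` [set x | g x = x]).
  by apply: finite_preimage fin => u v _ _; exact: f_inj.
rewrite (_ : _ @^-1` _ = setT); first exact: infinite_nat.
apply/seteqP; split=> // n _ /=; apply/point_fixed => i; rewrite mxE.
case: eqP => [->|_]; first by exists 0; rewrite dj mul0r.
by exists 0; rewrite mulr0.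
Qed.

Lemma nfix_finite : (forall i, d i != 0) -> nfix g = (\prod_i `|d i|)%N.
Proof.
move=> d0; pose T := {dffun forall i : 'I_4, 'I_(`|d i|)}.
pose h (k : T) : X := point (\col_i ((k i : nat)%:R / (d i)%:~R)).
have h_inj : injective h.
  move=> k l /point_eq/integral_colP kl; apply/ffunP => i; apply: val_inj.
  have [q] := kl i; rewrite !mxE; exact: torsion_point_inj.
have hS : [set x | g x = x] = [set` [fset h k | k in {: T}]%fset].
  apply/seteqP; split=> x /=.
    have [e ->] := point_surj x => /point_fixed fe.
    pose z i := projT1 (cid (fe i)).
    have zE i : (d i)%:~R * e i 0 = (z i)%:~R by rewrite /z; case: cid.
    have t i := torsion_point_repr (d0 i) (zE i).
    apply/imfsetP; exists (finfun (fun i => Ordinal (t i).1)) => //.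
    apply/point_eq/integral_colP => i; have [q qE] := (t i).2; exists q.
    by rewrite !mxE ffunE.
  move=> /imfsetP[k _ ->]; apply/point_fixed => i; exists (k i : nat)%:Z.
  by rewrite mxE mulrCA divff ?intr_eq0 // mulr1 pmulrn.
rewrite /nfix hS set_fsetK card_imfset //= -cardE card_dep_ffun.
rewrite foldrE big_map big_enum /=.
by apply: eq_bigr => i _; rewrite card_ord.
Qed.

(** Both sides are the product of the |d i|: the outer matrices of the Smith
    normal form have determinant 1 or -1, and a vanishing d i makes the set of
    fixed points infinite, for which nfix is 0. *)
Lemma nfix_Smith : nfix g = `|\det (A - 1%:M)|%N.
Proof.
rewrite Smith !det_mulmx det_diag !abszM.
have du B : B \in unitmx -> `|\det (B : 'M[int]_4)|%N = 1%N.
  move=> uB; have := congr1 (fun B => `|\det B|%N) (mulmxV uB).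
  by rewrite det_mulmx det1 abszM => /eqP; rewrite muln_eq1 => /andP[/eqP].
rewrite !du // mul1n muln1.
have -> : \prod_i (\row_i d i) 0 i = \prod_i d i by apply: eq_bigr => i _; rewrite mxE.
have [j /eqP dj|d0] := pickP (fun i => d i == 0).
  by rewrite (bigD1 j) //= dj mul0r (nfix_infinite dj).
rewrite nfix_finite; last by move=> i; rewrite d0.
by elim/big_rec2: _ => // i x y _ ->; rewrite abszM.
Qed.
End FixedPoints.

(** * Eigenvalues of the analytic and of the rational representation *)

Section Eigenvalues.
Local Open Scope classical_set_scope.
Local Open Scope complex_scope.
Variable R : realType.
Local Notation C := R[i].
Local Notation V := 'cV[C]_2.
Local Notation real_mx := (map_mx (real_complex R)).
Local Notation int_mx := (map_mx (intr : int -> R)).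

Definition rnorm (l : C) : R := complex.Re l ^+ 2 + complex.Im l ^+ 2.
Definition rtrace (l : C) : R := complex.Re l *+ 2.

Lemma mul_conjc (l : C) : l * conjc l = (rnorm l)%:C.
Proof.
case: l => x y; apply/eqP; rewrite eq_complex /rnorm /=.
by apply/andP; split; apply/eqP; ring.
Qed.

Lemma add_conjc (l : C) : l + conjc l = (rtrace l)%:C.
Proof.
case: l => x y; apply/eqP; rewrite eq_complex /rtrace /=.
by apply/andP; split; apply/eqP; ring.
Qed.

Lemma rnormM (l m : C) : rnorm (l * m) = rnorm l * rnorm m.
Proof. by case: l m => [x y] [u v]; rewrite /rnorm /=; ring. Qed.

Lemma rnorm_ge0 l : 0 <= rnorm l.
Proof. by rewrite addr_ge0 ?sqr_ge0. Qed.

Lemma det_mx22 (F : comRingType) (N : 'M[F]_2) :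
  \det N = N 0 0 * N 1 1 - N 0 1 * N 1 0.
Proof.
rewrite (expand_det_row _ 0) !big_ord_recl big_ord0 /cofactor !det_mx11 !mxE.
have -> : lift ord0 ord0 = 1 :> 'I_2 by apply: val_inj.
have -> : lift 1 0 = 0 :> 'I_2 by apply: val_inj.
by rewrite /= expr0 expr1; ring.
Qed.

Lemma det2_sub1 (F : comRingType) (N : 'M[F]_2) : \det (N - 1%:M) = \det N - \tr N + 1.
Proof.
rewrite !det_mx22 /mxtrace !big_ord_recl big_ord0 !mxE /=.
have -> : lift ord0 ord0 = 1 :> 'I_2 by apply: val_inj.
by rewrite addr0; ring.
Qed.

(** For 2 x 2 matrices, det (N - 1) = det N - tr N + 1, and Cayley-Hamilton
    gives the traces of the powers of M by a linear recurrence, with solution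
    l1^n + l2^n. *)
Lemma det_expr_sub1 (M : 'M[C]_2) l1 l2 n :
  char_poly M = ('X - l1%:P) * ('X - l2%:P) ->
  \det (M ^+ n - 1%:M) = (l1 ^+ n - 1) * (l2 ^+ n - 1).
Proof.
move=> e.
have pE : ('X - l1%:P) * ('X - l2%:P) = 'X^2 - (l1 + l2)%:P * 'X + (l1 * l2)%:P.
  by rewrite polyCD polyCM; ring.
have tM : \tr M = l1 + l2.
  apply: oppr_inj; rewrite -char_poly_trace // e pE !coefE /=; ring.
have dM : \det M = l1 * l2.
  have := char_poly_det M; rewrite e pE !coefE /= expr2 mulrNN !mul1r => <-; ring.
have dn k : \det (M ^+ k) = (l1 * l2) ^+ k.
  by elim: k => [|k IH]; rewrite ?expr0 ?det1 // !exprS det_mulmx IH dM.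
have CH : M ^+ 2 = (l1 + l2) *: M - (l1 * l2)%:M.
  have := Cayley_Hamilton M; rewrite e pE; move: (l1 + l2) (l1 * l2) => u v.
  rewrite (rmorphD (horner_mx M)) (rmorphB (horner_mx M)) (rmorphM (horner_mx M) u%:P).
  rewrite (rmorphXn (horner_mx M)) /= horner_mx_X !horner_mx_C.
  rewrite -[u%:M * M]/(u%:M *m M) mul_scalar_mx => /eqP.
  by rewrite addr_eq0 subr_eq addrC => /eqP.
have tn k : \tr (M ^+ k) = l1 ^+ k + l2 ^+ k /\ \tr (M ^+ k.+1) = l1 ^+ k.+1 + l2 ^+ k.+1.
  elim: k => [|k [IH1 IH2]]; first by rewrite expr0 mxtrace1 !expr1 tM.
  split=> //; have -> : M ^+ k.+2 = (l1 + l2) *: M ^+ k.+1 - (l1 * l2) *: M ^+ k.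
    rewrite -[k.+2]/(2 + k)%N exprD CH mulrBl exprS -!mulmxE mul_scalar_mx.
    by rewrite -scalemxAl.
  by rewrite raddfB /= !mxtraceZ IH1 IH2 !exprS; ring.
rewrite det2_sub1 dn (tn n).1 exprMn; ring.
Qed.

Lemma char_poly_similar n (P A D : 'M[C]_n) : P \in unitmx ->
  P *m A = D *m P -> char_poly A = char_poly D.
Proof.
move=> uP PA; pose Q := map_mx polyC P.
have Q0 : \det Q != 0 by rewrite det_map_mx polyC_eq0 -unitfE -unitmxE.
apply: (mulfI Q0); rewrite [RHS]mulrC /char_poly -!det_mulmx; congr (\det _).
rewrite /char_poly_mx mulmxBr mulmxBl scalar_mxC; congr (_ - _).
by rewrite -!map_mxM PA.
Qed.

Section Conjugation.
Variables (X : complex_torus R) (b : 'I_4 -> V).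
Hypothesis b_free : real_free b.
Variables (N : 'M[C]_2) (B : 'M[int]_4).
Hypothesis NB : N *m period_mx b = period_mx b *m real_mx (int_mx B).

Let P : 'M[C]_(2 + 2, 4) := full_period_mx b.
Let P_unit : (P : 'M[C]_4) \in unitmx := full_period_unit b_free.

(** B is real, so conjugating the relation between N and B gives the relation
    for the lower half. *)
Lemma full_period_intertwine :
  P *m real_mx (int_mx B) = block_mx N 0 0 (map_mx conjc N) *m P.
Proof.
rewrite mul_col_mx mul_block_col !mul0mx addr0 add0r NB -map_mxM NB map_mxM.
by congr (col_mx _ (_ *m _)); apply/matrixP => i j;
  rewrite [RHS]mxE !mxE; exact/esym/conjc_real.
Qed.

Lemma det_conjugate : ((\det B)%:~R : R) = rnorm (\det N).
Proof.
apply: complexI; rewrite -mul_conjc.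
have : \det (P : 'M[C]_4) * \det (real_mx (int_mx B)) =
    (\det N * conjc (\det N)) * \det (P : 'M[C]_4).
  transitivity (\det (P *m real_mx (int_mx B) : 'M[C]_4)).
    by rewrite [RHS](@det_mulmx C 4).
  rewrite full_period_intertwine [LHS](@det_mulmx C (2 + 2)); congr (_ * _).
  by rewrite det_ublock det_map_mx.
rewrite mulrC => /(mulIf _) <-; last by rewrite -unitfE -unitmxE.
by rewrite !det_map_mx.
Qed.

Lemma char_poly_conjugate :
  map_poly (real_complex R \o intr) (char_poly B) = char_poly N * map_poly conjc (char_poly N).
Proof.
rewrite (map_char_poly conjc) (map_char_poly (real_complex R \o intr)).
have PB : P *m map_mx (real_complex R \o intr) B =
    (block_mx N 0 0 (map_mx conjc N) : 'M[C]_4) *m P.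
  by rewrite map_mx_comp; exact: full_period_intertwine.
rewrite (char_poly_similar P_unit PB) /char_poly.
rewrite -[RHS](@det_ublock _ 2 2 _ 0); congr (\det _).
exact: (@char_block_diag_mx C 2 2).
Qed.
End Conjugation.


Lemma iter_analytic_rep (X : complex_torus R) (f : X -> X) M n :
  is_analytic_rep f M -> is_analytic_rep (iter n f) (M ^+ n).
Proof.
move=> fM v; elim: n => [|n IH]; first by rewrite /= expr0 mul1mx.
by rewrite iterS IH fM exprS mulmxA.
Qed.

Lemma period_expr (b : 'I_4 -> V) (M : 'M[C]_2) (A : 'M[int]_4) n :
  M *m period_mx b = period_mx b *m real_mx (int_mx A) ->
  M ^+ n *m period_mx b = period_mx b *m real_mx (int_mx (A ^+ n)).
Proof.
move=> MA; elim: n => [|n IH].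
  by rewrite !expr0 mul1mx !map_mx1 mulmx1.
by rewrite exprS -mulmxE -mulmxA IH mulmxA MA exprS -mulmxE !map_mxM mulmxA.
Qed.

(** f 0 = 0 forces M to map the lattice to itself. *)
Lemma rational_rep (X : complex_torus R) (f : {additive X -> X}) (b : 'I_4 -> V) M :
  real_free b -> lattice X = integer_span b -> is_analytic_rep f M ->
  exists A : 'M[int]_4, M *m period_mx b = period_mx b *m real_mx (int_mx A).
Proof.
move=> bf eX fM.
have bL j : lattice X (b j).
  rewrite eX; exists (fun i => (i == j)%:R); rewrite (bigD1 j) //= eqxx mulr1z.
  by rewrite big1 ?addr0 // => i /negbTE ->; rewrite mulr0z.
have ML j : exists m : 'cV[int]_4, M *m b j = period_mx b *m real_mx (int_mx m).
  apply/(mem_latticeE eX); rewrite -[M *m b j]subr0; apply/torus_projE.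
  rewrite -[0](mulmx0 _ M) -!fM; congr (f _); apply/torus_projE.
  by rewrite subr0.
pose m j := projT1 (cid (ML j)).
have mE j : M *m b j = period_mx b *m real_mx (int_mx (m j)) by rewrite /m; case: cid.
exists (\matrix_(i, j) m j i 0); apply/matrixP => k j.
have := congr1 (fun v : V => v k 0) (mE j); rewrite !mxE => h.
have bE i : period_mx b i j = b j i 0 by rewrite mxE.
under eq_bigr do rewrite bE; rewrite h; apply: eq_bigr => i _; rewrite !mxE //.
Qed.

Lemma nfix_iter (X : complex_torus R) (f : {additive X -> X}) l1 l2 n :
  holomorphic f -> eigenvalues f l1 l2 ->
  (nfix (iter n f))%:R = rnorm (l1 ^+ n - 1) * rnorm (l2 ^+ n - 1).
Proof.
move=> hf ev; have [b bf eX] := latticeP X.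
have fM : is_analytic_rep f (rho_a f) by apply/(rho_aP _ hf).
have [A MA] := rational_rep bf eX fM.
have MAn := period_expr n MA; have fMn := iter_analytic_rep n fM.
have [L uL [U uU [d _ Smith]]] := int_Smith_normal_form (A ^+ n - 1%:M).
have Smith' : A ^+ n - 1%:M = L *m diag_mx (\row_i d`_i) *m U.
  rewrite Smith; congr (_ *m _ *m _); apply/matrixP => i j; rewrite !mxE.
  by rewrite -[in RHS]val_eqE.
rewrite (nfix_Smith bf eX fMn MAn uL uU Smith').
have NB : (rho_a f ^+ n - 1%:M) *m period_mx b =
    period_mx b *m real_mx (int_mx (A ^+ n - 1%:M)).
  by rewrite mulmxBl MAn !map_mxB !map_mx1 mulmxBr mulmx1 mul1mx.
have dE := det_conjugate bf NB.
rewrite (det_expr_sub1 n ev) rnormM in dE.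
rewrite -dE pmulrn gez0_abs // -(ler0z R) dE.
by rewrite mulr_ge0 ?rnorm_ge0.
Qed.

(** These are, up to sign, the coefficients of the characteristic polynomial of
    the rational representation. *)
Lemma eigenvalues_integrality (X : complex_torus R) (f : {additive X -> X}) l1 l2 :
  holomorphic f -> eigenvalues f l1 l2 ->
  exists a b c e : int, [/\ rtrace l1 + rtrace l2 = a%:~R,
    rtrace l1 * rtrace l2 + rnorm l1 + rnorm l2 = b%:~R,
    rtrace l1 * rnorm l2 + rtrace l2 * rnorm l1 = c%:~R &
    rnorm l1 * rnorm l2 = e%:~R].
Proof.
move=> hf ev; have [b bf eX] := latticeP X.
have fM : is_analytic_rep f (rho_a f) by apply/(rho_aP _ hf).
have [A MA] := rational_rep bf eX fM.
have := char_poly_conjugate bf MA; rewrite ev.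
have -> : map_poly conjc (('X - l1%:P) * ('X - l2%:P)) =
    ('X - (conjc l1)%:P) * ('X - (conjc l2)%:P).
  by rewrite rmorphM !rmorphB /= !map_polyX !map_polyC.
have -> : ('X - l1%:P) * ('X - l2%:P) * (('X - (conjc l1)%:P) * ('X - (conjc l2)%:P)) =
    'X^4 - (rtrace l1 + rtrace l2)%:C%:P * 'X^3
    + (rtrace l1 * rtrace l2 + rnorm l1 + rnorm l2)%:C%:P * 'X^2
    - (rtrace l1 * rnorm l2 + rtrace l2 * rnorm l1)%:C%:P * 'X
    + (rnorm l1 * rnorm l2)%:C%:P.
  have CD (x y : R) : (x + y)%:C = x%:C + y%:C :> C by exact: rmorphD.
  have CM (x y : R) : (x * y)%:C = x%:C * y%:C :> C by exact: rmorphM.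
  move: (add_conjc l1) (add_conjc l2) (mul_conjc l1) (mul_conjc l2).
  move: (rtrace l1) (rtrace l2) (rnorm l1) (rnorm l2) => t1 t2 n1 n2 h1 h2 h3 h4.
  rewrite !(CD, CM) -h1 -h2 -h3 -h4 !(polyCD, polyCM); ring.
move: (char_poly A) => p /polyP pE.
have := pE 0%N; have := pE 1%N; have := pE 2%N; have := pE 3%N.
rewrite !coef_map !coefE /= !(mulr1, mulr0, add0r, addr0, sub0r, subr0, oppr0).
have CN (x : R) : - x%:C = (- x)%:C :> C by rewrite rmorphN.
rewrite !CN => /complexI h3 /complexI h2 /complexI h1 /complexI h0.
exists (- p`_3), p`_2, (- p`_1), p`_0.
by rewrite !rmorphN /= h0 h1 h2 h3 !opprK.
Qed.

End Eigenvalues.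

(** * Integral quartics with two pairs of conjugate roots *)

Section Classification.
Local Open Scope classical_set_scope.
Local Open Scope complex_scope.
Variable R : realType.
Local Notation C := R[i].
Implicit Types (l : C) (t x : R).

Lemma rnorm_eq0 l : (rnorm l == 0) = (l == 0).
Proof.
by case: l => x y; rewrite /rnorm /= eq_complex /= paddr_eq0 ?sqr_ge0 // !sqrf_eq0.
Qed.

Lemma rtrace_sqr_le l : rtrace l ^+ 2 <= 4 * rnorm l.
Proof. by case: l => x y; rewrite /rnorm /rtrace /=; have := sqr_ge0 y; nra. Qed.

Lemma quadratic_eq l : l ^+ 2 = (rtrace l)%:C * l - (rnorm l)%:C.
Proof. by rewrite -add_conjc -mul_conjc; ring. Qed.

(** A rational root of a monic integral polynomial is an integer.  The square
    of 2 x - a is the integral discriminant; being rational, 2 x - a is then an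
    integer, of the parity of a. *)
Lemma rational_root_int x (a b k f : int) : k != 0 -> k%:~R * x = f%:~R ->
  x ^+ 2 - a%:~R * x + b%:~R = 0 -> exists z : int, x = z%:~R.
Proof.
move=> k0 kx xe; pose m := f * 2 - a * k.
have kR : k%:~R != 0 :> R by rewrite intr_eq0.
have mE : m%:~R = k%:~R * (x * 2 - a%:~R).
  by rewrite /m rmorphB !rmorphM /= -kx; ring.
have mm : m ^+ 2 = k ^+ 2 * (a ^+ 2 - b * 4).
  apply: (@intr_inj R); rewrite rmorphXn /= mE rmorphM rmorphB !rmorphXn rmorphM /=.
  have -> : (b%:~R : R) = - (x ^+ 2 - a%:~R * x) by apply/eqP; rewrite -addr_eq0 addrC xe.
  by rewrite -[4%:~R]/(4 : R); ring.
have /dvdzP[j mj] : (k %| m)%Z.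
  have : (k ^+ 2 %| m ^+ 2)%Z by rewrite mm dvdz_mulr.
  by rewrite !dvdzE !abszX dvdn_pexp2r.
have xj : x * 2 = (a + j)%:~R.
  apply: (mulfI kR); have := mE; rewrite mj rmorphM /= => h.
  have -> : k%:~R * (a + j)%:~R = k%:~R * a%:~R + j%:~R * k%:~R :> R.
    by rewrite rmorphD /=; ring.
  by rewrite h; ring.
have jj : j ^+ 2 = a ^+ 2 - b * 4.
  have k20 : k ^+ 2 != 0 by rewrite expf_neq0.
  by apply: (mulfI k20); rewrite -mm mj; ring.
have [r rE] : exists r : int, a + j = r * 2.
  exists ((a + j) %/ 2)%Z; rewrite divzK //.
  have : (2 %| (a + j) ^+ 2)%Z.
    apply/dvdzP; exists (a ^+ 2 + a * j - b * 2).
    by rewrite sqrrD jj; ring.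
  by rewrite !dvdzE !abszX Euclid_dvdX // andbT.
exists r; have two0 : (2 : R) != 0 by rewrite pnatr_eq0.
by apply: (mulIf two0); rewrite xj rE rmorphM.
Qed.

(** The order of l on the unit circle when 2 Re l = z, for z in [-2, 2]; the
    default branch covers z = -2. *)
Definition trace_order (z : int) : nat :=
  match z with
  | 2%:Z => 1 | 1%:Z => 6 | 0%:Z => 4 | Negz 0 => 3 | _ => 2
  end.

Lemma unit_root_of_trace l (z : int) : rnorm l = 1 -> rtrace l = z%:~R ->
  l ^+ trace_order z = 1.
Proof.
move=> n1 tz; have h := quadratic_eq l; rewrite n1 tz in h.
have z4 : z ^+ 2 <= 4.
  have := rtrace_sqr_le l; rewrite n1 tz mulr1 -rmorphXn /=.
  by rewrite -[4 : R]/(4%:~R) ler_int.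
have : - 2 <= z <= 2 by nia.
have sq0 (e : C) : (l - e) ^+ 2 = 0 -> l = e.
  by move=> /eqP; rewrite sqrf_eq0 subr_eq0 => /eqP.
case: z h {tz z4} => [[|[|[|//]]]|[|[|//]]] /= h _.
- have h2 : l ^+ 2 = - 1 by rewrite h; ring.
  by rewrite -[4%N]/(2 * 2)%N exprM h2; ring.
- have h2 : l ^+ 2 = l - 1 by rewrite h; ring.
  by ring: h2.
- by rewrite (sq0 1) ?expr1 // sqrrB h; ring.
- have h2 : l ^+ 2 = - l - 1 by rewrite h; ring.
  by ring: h2.
- by rewrite (sq0 (-1)) ?sqrrN ?expr1n // opprK sqrrD h; ring.
Qed.

Lemma exprK_dvd l k K : (k %| K)%N -> l ^+ k = 1 -> l ^+ K = 1.
Proof. by move=> /dvdnP[q ->] h; rewrite mulnC exprM h expr1n. Qed.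

Lemma trace_order_dvd12 z : (trace_order z %| 12)%N.
Proof. by case: z => [[|[|[|n]]]|[|n]]. Qed.

Definition orders := [:: 1; 2; 3; 4; 5; 6; 8; 10; 12]%N.

Definition nonzero_torsion k l1 l2 := forall l, l \in [:: l1; l2] -> l != 0 -> l ^+ k = 1.

(** The traces t1, t2 are the roots of Y^2 - a Y + p.  That both lie in [-2, 2]
    bounds a and p, leaving 19 cases.  In fifteen of them the polynomial splits
    over Z; in the four others the orders of l1 and l2 are both 5, 8, 10 or 12. *)
Lemma unit_circle_torsion l1 l2 (a p : int) : rnorm l1 = 1 -> rnorm l2 = 1 ->
  rtrace l1 + rtrace l2 = a%:~R -> rtrace l1 * rtrace l2 = p%:~R ->
  exists2 k, k \in orders & nonzero_torsion k l1 l2.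
Proof.
move=> n1 n2 sE pE.
have t1 := rtrace_sqr_le l1; have t2 := rtrace_sqr_le l2.
rewrite n1 n2 !mulr1 in t1 t2.
have root l : l \in [:: l1; l2] ->
    rnorm l = 1 /\ rtrace l ^+ 2 = a%:~R * rtrace l - p%:~R.
  by rewrite !inE => /orP[]/eqP ->; split=> //; rewrite -sE -pE; ring.
have int_case k (z z' : int) : a = z + z' -> p = z * z' ->
    (trace_order z %| k)%N -> (trace_order z' %| k)%N -> nonzero_torsion k l1 l2.
  move=> aE pzE kz kz' l /root[nl tl] _.
  have /eqP : (rtrace l - z%:~R) * (rtrace l - z'%:~R) = 0.
    have -> : (rtrace l - z%:~R) * (rtrace l - z'%:~R) =
      rtrace l ^+ 2 - (z%:~R + z'%:~R) * rtrace l + z%:~R * z'%:~R by ring.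
    by rewrite tl aE pzE rmorphD rmorphM /=; ring.
  rewrite mulf_eq0 !subr_eq0 => /orP[]/eqP tz.
    exact: exprK_dvd kz (unit_root_of_trace nl tz).
  exact: exprK_dvd kz' (unit_root_of_trace nl tz).
have bound (x y : R) : x ^+ 2 <= 4 -> y ^+ 2 <= 4 ->
   [/\ 0 <= 4 - 2 * (x + y) + x * y, 0 <= 4 + 2 * (x + y) + x * y,
     4 * (x * y) <= (x + y) ^+ 2 & - 4 <= x + y <= 4].
  move=> x2 y2; have [x3 x4] : x <= 2 /\ -2 <= x by nra.
  have [y3 y4] : y <= 2 /\ -2 <= y by nra.
  split; [nra|nra| |lra]; have := sqr_ge0 (x - y); nra.
have [] := bound _ _ t1 t2; rewrite sE pE.
have I4 : (4 : R) = 4%:~R by []. have I2 : (2 : R) = 2%:~R by [].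
rewrite I4 I2 -!rmorphXn -!rmorphM -?rmorphN -!rmorphD -?rmorphB -?rmorphD /= !ler_int !ler0z.
move=> b1 b2 b3 /andP[b4 b5].
have aD : a = -4 \/ a = -3 \/ a = -2 \/ a = -1 \/ a = 0 \/ a = 1 \/
  a = 2 \/ a = 3 \/ a = 4 by lia.
have irr_case k : (forall (l t : C), l ^+ 2 = t * l - 1 ->
    t ^+ 2 = a%:~R * t - p%:~R -> l ^+ k = 1) -> nonzero_torsion k l1 l2.
  move=> H l /root[nl tl] _; apply: (H l (rtrace l)%:C).
    by rewrite quadratic_eq nl.
  have IC (m : int) : m%:~R = (m%:~R)%:C :> C by rewrite rmorph_int.
  by rewrite -rmorphXn tl rmorphB rmorphM /= !IC.
case: aD => [aE|aD].
  have pE' : p = 4 by lia.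
  rewrite aE pE' in irr_case int_case *; by exists 2%N => //; apply: (int_case _ (-2) (-2)).
case: aD => [aE|aD].
  have pE' : p = 2 by lia.
  rewrite aE pE' in irr_case int_case *; by exists 6%N => //; apply: (int_case _ (-2) (-1)).
case: aD => [aE|aD].
  have pD : p = 0 \/ p = 1 by lia.
  case: pD => [pE'|pE']; rewrite aE pE' in irr_case int_case.
  - by exists 4%N => //; apply: (int_case _ (-2) (0)).
  - by exists 3%N => //; apply: (int_case _ (-1) (-1)).
case: aD => [aE|aD].
  have pD : p = -2 \/ p = -1 \/ p = 0 by lia.
  case: pD => [pE'|[pE'|pE']]; rewrite aE pE' in irr_case int_case.
  - by exists 6%N => //; apply: (int_case _ (-2) (1)).
  - exists 5%N => //; apply: irr_case => l t hl ht; rewrite /= in ht; by ring: hl ht.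
  - by exists 12%N => //; apply: (int_case _ (-1) (0)).
case: aD => [aE|aD].
  have pD : p = -4 \/ p = -3 \/ p = -2 \/ p = -1 \/ p = 0 by lia.
  case: pD => [pE'|[pE'|[pE'|[pE'|pE']]]]; rewrite aE pE' in irr_case int_case.
  - by exists 2%N => //; apply: (int_case _ (2) (-2)).
  - exists 12%N => //; apply: irr_case => l t hl ht; rewrite /= in ht; by ring: hl ht.
  - exists 8%N => //; apply: irr_case => l t hl ht; rewrite /= in ht; by ring: hl ht.
  - by exists 6%N => //; apply: (int_case _ (1) (-1)).
  - by exists 4%N => //; apply: (int_case _ (0) (0)).
case: aD => [aE|aD].
  have pD : p = -2 \/ p = -1 \/ p = 0 by lia.
  case: pD => [pE'|[pE'|pE']]; rewrite aE pE' in irr_case int_case.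
  - by exists 3%N => //; apply: (int_case _ (2) (-1)).
  - exists 10%N => //; apply: irr_case => l t hl ht; rewrite /= in ht; by ring: hl ht.
  - by exists 12%N => //; apply: (int_case _ (1) (0)).
case: aD => [aE|aD].
  have pD : p = 0 \/ p = 1 by lia.
  case: pD => [pE'|pE']; rewrite aE pE' in irr_case int_case.
  - by exists 4%N => //; apply: (int_case _ (2) (0)).
  - by exists 6%N => //; apply: (int_case _ (1) (1)).
case: aD => [aE|aD].
  have pE' : p = 2 by lia.
  rewrite aE pE' in irr_case int_case *; by exists 6%N => //; apply: (int_case _ (2) (1)).
have aE := aD.
have pE' : p = 4 by lia.
rewrite aE pE' in irr_case int_case *; by exists 1%N => //; apply: (int_case _ (2) (2)).
Qed.

Variant eigenvalue_type l1 l2 : Prop :=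
| Hyperbolic of rnorm l1 != 1 & rnorm l2 != 1 & (1 < rnorm l1) || (1 < rnorm l2)
| RootExpanding of l1 ^+ 12 = 1 & 1 < rnorm l2
| ExpandingRoot of 1 < rnorm l1 & l2 ^+ 12 = 1
| Torsion k of k \in orders & nonzero_torsion k l1 l2.

Lemma eigenvalue_typeC l1 l2 : eigenvalue_type l1 l2 -> eigenvalue_type l2 l1.
Proof.
case=> [n1 n2 h|h1 h2|h1 h2|k hk h].
- by apply: Hyperbolic; rewrite // orbC.
- exact: ExpandingRoot.
- exact: RootExpanding.
- by apply: (Torsion hk) => l lP; apply: h; move: lP; rewrite !inE orbC.
Qed.

(** With n1 = 1 and n2 = e the integrality relations read t1 + t2 = a,
    t1 t2 = b - 1 - e and t1 e + t2 = c.  Eliminating t2 gives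
    (e - 1) t1 = c - a and t1^2 - a t1 + (b - 1 - e) = 0. *)
Lemma unit_eigenvalue_type l1 l2 (a b c e : int) : rnorm l1 = 1 ->
  rtrace l1 + rtrace l2 = a%:~R ->
  rtrace l1 * rtrace l2 + rnorm l1 + rnorm l2 = b%:~R ->
  rtrace l1 * rnorm l2 + rtrace l2 * rnorm l1 = c%:~R ->
  rnorm l1 * rnorm l2 = e%:~R -> eigenvalue_type l1 l2.
Proof.
move=> n1; rewrite n1 mul1r mulr1 => ha hb hc he; rewrite he in hb hc.
have [e1|e1] := eqVneq e 1.
  rewrite e1 in he hb hc; have [|k hk h] := @unit_circle_torsion l1 l2 a (b - 2) n1 he ha.
    by rewrite rmorphB /= -hb; ring.
  exact: Torsion hk h.
have [z zE] : exists z : int, rtrace l1 = z%:~R.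
  apply: (@rational_root_int (rtrace l1) a (b - 1 - e) (e - 1) (c - a)).
  - by rewrite subr_eq0.
  - by rewrite !rmorphB /= -hc -ha; ring.
  - by rewrite !rmorphB /= -ha -hb; ring.
have l1z := unit_root_of_trace n1 zE.
have e0 : 0 <= e by rewrite -(ler0z R) -he rnorm_ge0.
have [e00|e00] := eqVneq e 0.
  have l20 : l2 = 0 by apply/eqP; rewrite -rnorm_eq0 he e00.
  apply: (@Torsion _ _ (trace_order z)).
    by case: (z) => [[|[|[|n]]]|[|n]].
  by move=> l; rewrite !inE => /orP[]/eqP -> //; rewrite l20 eqxx.
apply: RootExpanding; first exact: exprK_dvd (trace_order_dvd12 z) l1z.
by rewrite he ltr1z; lia.
Qed.

Lemma classify_eigenvalues l1 l2 (a b c e : int) :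
  rtrace l1 + rtrace l2 = a%:~R ->
  rtrace l1 * rtrace l2 + rnorm l1 + rnorm l2 = b%:~R ->
  rtrace l1 * rnorm l2 + rtrace l2 * rnorm l1 = c%:~R ->
  rnorm l1 * rnorm l2 = e%:~R -> eigenvalue_type l1 l2.
Proof.
move=> ha hb hc he.
have [n1|n1] := eqVneq (rnorm l1) 1; first exact: unit_eigenvalue_type ha hb hc he.
have [n2|n2] := eqVneq (rnorm l2) 1.
  apply: eigenvalue_typeC.
  apply: (@unit_eigenvalue_type l2 l1 a b c e) => //.
  - by rewrite addrC.
  - by rewrite -hb; ring.
  - by rewrite -hc; ring.
  - by rewrite mulrC.
have [g1|g1] := ltP 1 (rnorm l1); first by apply: Hyperbolic; rewrite ?g1.
have [g2|g2] := ltP 1 (rnorm l2); first by apply: Hyperbolic; rewrite ?g2 ?orbT.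
have lt1 : rnorm l1 < 1 by rewrite lt_neqAle n1.
have lt2 : rnorm l2 < 1 by rewrite lt_neqAle n2.
have p1 := rnorm_ge0 l1; have p2 := rnorm_ge0 l2.
have e0 : e = 0.
  have : (e%:~R : R) < 1 by rewrite -he mulr_ilt1.
  have : 0 <= (e%:~R : R) by rewrite -he mulr_ge0.
  by rewrite ler0z ltrz1; lia.
have zero l l' : l = 0 -> rnorm l' < 1 ->
    rnorm l + rnorm l' + rtrace l * rtrace l' = b%:~R -> l' = 0.
  move=> ->; rewrite /rnorm /rtrace /= expr0n /= mul0rn mul0r !addr0 !add0r.
  rewrite -/(rnorm l') => lt hb'.
  have nb : rnorm l' = b%:~R by rewrite -hb'.
  apply/eqP; rewrite -rnorm_eq0; move: (rnorm_ge0 l') lt; rewrite nb ler0z ltrz1 intr_eq0.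
  by move=> ? ?; apply/eqP; lia.
have [l10 l20] : l1 = 0 /\ l2 = 0.
  move: he; rewrite e0 => /eqP; rewrite mulf_eq0 !rnorm_eq0 => /orP[]/eqP l0.
    by split=> //; apply: (zero l1) => //; rewrite -hb; ring.
  by split=> //; apply: (zero l2) => //; rewrite -hb; ring.
apply: (@Torsion _ _ 1); first by [].
by move=> l; rewrite l10 l20 !inE => /orP[]/eqP ->; rewrite eqxx.
Qed.

End Classification.

(** * Growth and periodicity of sequences *)

Section Sequences.
Local Open Scope classical_set_scope.
Local Open Scope complex_scope.
Variable R : realType.
Implicit Types (u h : nat -> nat).

Lemma expr_unbounded (q K : R) : 1 < q -> exists N : nat, forall n, (N <= n)%N -> K <= q ^+ n.
Proof.
move=> q1; have q0 : 0 < q - 1 by rewrite subr_gt0.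
have bern n : 1 + (q - 1) *+ n <= q ^+ n.
  elim: n => [|n IH]; first by rewrite expr0 mulr0n addr0.
  have h : 0 <= (q - 1) *+ n by rewrite mulrn_wge0 // ltW.
  by rewrite exprS mulrSr; nra.
exists (Num.bound `|K / (q - 1)|) => n hn.
apply: le_trans (bern n); rewrite -mulr_natr.
have : K / (q - 1) <= n%:R.
  apply: le_trans (ler_norm _) _; apply: ltW.
  by apply: lt_le_trans (archi_boundP (normr_ge0 _)) _; rewrite ler_nat.
by rewrite ler_pdivrMr //; lra.
Qed.

Lemma periodic_bounded u : periodic_sequence u ->
  exists K, forall n, (0 < n)%N -> (u n <= K)%N.
Proof.
move=> [p p0 up]; exists (\max_(i < p) u i.+1) => n n0.
have upk k m : (0 < m)%N -> u (m + k * p)%N = u m.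
  elim: k => [|k IH] m0; first by rewrite mul0n addn0.
  by rewrite mulSn addnCA addnC up ?IH // addn_gt0 m0.
have -> : u n = u (n.-1 %% p)%N.+1.
  by rewrite -(upk (n.-1 %/ p)%N (n.-1 %% p)%N.+1) // addSn addnC -divn_eq prednK.
exact: (leq_bigmax (Ordinal (ltn_pmod n.-1 p0))).
Qed.

Lemma growth_unbounded h K : exp_growth R h ->
  exists N, forall n, (N <= n)%N -> (K < h n)%N.
Proof.
move=> [A [B [A1 _ [N1 hN]]]]; have [N2 hN2] := expr_unbounded (K%:R + 1) A1.
exists (maxn N1 N2) => n; rewrite geq_max => /andP[n1 n2].
have [h1 _] := hN n n1; have := le_trans (hN2 n n2) h1.
by rewrite natr1 ler_nat.
Qed.

Lemma exp_growth_not_periodic u : exp_growth R u -> ~ periodic_sequence u.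
Proof.
move=> g /periodic_bounded[K hK]; have [N hN] := growth_unbounded K g.
by have := hN N.+1 (leqnSn N); rewrite ltnNge hK.
Qed.

Lemma off_multiples_not_periodic u : exp_growth_off_multiples R u -> ~ periodic_sequence u.
Proof.
move=> [r [h [r2 g uE]]] /periodic_bounded[K hK]; have [N hN] := growth_unbounded K g.
(* The index 1 + r N is large and not a multiple of r. *)
have nr : (r %| 1 + r * N)%N = false.
  by rewrite dvdn_addl ?dvdn_mulr // dvdn1; apply/eqP => r1; rewrite r1 in r2.
have := hK (1 + r * N)%N isT; rewrite uE // nr leqNgt hN //.
by nia.
Qed.

Lemma exp_growth_not_off_multiples u :
  exp_growth R u -> ~ exp_growth_off_multiples R u.
Proof.
move=> g [r [h [r2 _ uE]]]; have [N hN] := growth_unbounded 0 g.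
have r0 : (0 < r)%N by apply: leq_trans r2.
have : (0 < u (r * N.+1))%N by apply: hN; nia.
by rewrite uE ?muln_gt0 ?r0 // dvdn_mulr.
Qed.

(** Used for the distances from 1 of the powers of a root of unity. *)
Lemma finite_min (F : nat -> R) N : (forall k, 0 <= F k) ->
  exists2 e, 0 < e & forall k, (k < N)%N -> F k != 0 -> e <= F k.
Proof.
move=> F0; elim: N => [|N [e e0 IH]]; first by exists 1.
have [z|nz] := eqVneq (F N) 0.
  exists e => // k; rewrite ltnS leq_eqVlt => /orP[/eqP ->|/IH //].
  by rewrite z eqxx.
exists (Num.min e (F N)).
  by rewrite lt_min e0 lt_neqAle eq_sym nz F0.
move=> k; rewrite ltnS leq_eqVlt => /orP[/eqP -> _|/IH h /h le].
  by rewrite ge_min lexx orbT.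
by rewrite ge_min le.
Qed.
End Sequences.

Section Growth.
Local Open Scope classical_set_scope.
Local Open Scope complex_scope.
Variable R : realType.
Local Notation C := R[i].
Implicit Types (l : C) (n : nat).

Definition modulus l : R := Num.sqrt (rnorm l).

Lemma modulusE l : `|l| = (modulus l)%:C.
Proof. by rewrite normc_def. Qed.

Lemma modulus_ge0 l : 0 <= modulus l. Proof. exact: sqrtr_ge0. Qed.

Lemma modulus_sqr l : modulus l ^+ 2 = rnorm l.
Proof. by rewrite sqr_sqrtr ?rnorm_ge0. Qed.

Lemma modulusX l n : modulus (l ^+ n) = modulus l ^+ n.
Proof.
by apply: complexI; rewrite -modulusE normrX modulusE rmorphXn.
Qed.

Lemma modulus_gt1 l : (1 < modulus l) = (1 < rnorm l).
Proof. rewrite -modulus_sqr; have := modulus_ge0 l; move: (modulus l) => q q0.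
by apply/idP/idP => h; nra. Qed.

Lemma modulus_eq1 l : (modulus l == 1) = (rnorm l == 1).
Proof. by rewrite -modulus_sqr pexpr_eq1 // modulus_ge0. Qed.

Lemma rnorm_sub1_ge l : (modulus l - 1) ^+ 2 <= rnorm (l - 1).
Proof.
have : complex.Re l <= modulus l.
  by apply: le_trans (ler_norm _) _; rewrite -sqrtr_sqr ler_wsqrtr // lerDl sqr_ge0.
have := modulus_sqr l; rewrite /rnorm; case: l => x y /=; nra.
Qed.

Lemma rnorm_sub1_le l : rnorm (l - 1) <= (modulus l + 1) ^+ 2.
Proof.
have : - complex.Re l <= modulus l.
  rewrite lerNl; apply: (@le_trans _ _ (- `|complex.Re l|)); last first.
    by rewrite lerNl -normrN ler_norm.
  by rewrite lerN2 -sqrtr_sqr ler_wsqrtr // lerDl sqr_ge0.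
have := modulus_sqr l; rewrite /rnorm; case: l => x y /=; nra.
Qed.

Lemma rnorm_exp_sub1_gap l : modulus l != 1 -> exists2 e, 0 < e &
  forall n, (0 < n)%N -> e <= rnorm (l ^+ n - 1).
Proof.
move=> l1; exists ((modulus l - 1) ^+ 2).
  by rewrite exprn_even_gt0 // subr_eq0.
case=> // n _; apply: le_trans (rnorm_sub1_ge _); rewrite modulusX.
have := modulus_ge0 l; move: (modulus l) l1 => q q1 q0.
have [g|g] := leP 1 q.
  have : q <= q ^+ n.+1 by rewrite exprS ler_peMr // exprn_ege1.
  nra.
have : q ^+ n.+1 <= q by rewrite exprS ler_piMr // exprn_ile1 // ltW.
have : 0 <= q ^+ n.+1 by exact: exprn_ge0.
nra.
Qed.

(** Writing y for the n-th power of the modulus of l1, the first factor is at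
    least (y - 1)^2 >= y (y - 2), and (y - 2) e >= 1 as soon as
    y >= 2 + 1 / e. *)
Lemma exp_lower_bound l1 l2 (e : R) : 1 < modulus l1 -> 0 < e -> exists N : nat,
  forall n, (N <= n)%N -> e <= rnorm (l2 ^+ n - 1) ->
    modulus l1 ^+ n <= rnorm (l1 ^+ n - 1) * rnorm (l2 ^+ n - 1).
Proof.
move=> q1 e0; have [N hN] := expr_unbounded (2 + e^-1) q1.
exists N => n /hN hn he.
have h1 := rnorm_sub1_ge (l1 ^+ n); rewrite modulusX in h1.
move: hn h1; set y := modulus l1 ^+ n => hn h1.
apply: (@le_trans _ _ ((y - 1) ^+ 2 * e)); last first.
  by apply: ler_pM => //; [exact: sqr_ge0|exact: ltW].
have ei0 : 0 < e^-1 by rewrite invr_gt0.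
have y2 : 1 <= (y - 2) * e by rewrite -ler_pdivrMr // div1r; lra.
have y0 : 0 < y by lra.
apply: (@le_trans _ _ (y * ((y - 2) * e))); first by rewrite ler_peMr // ltW.
nra.
Qed.

Lemma exp_upper_bound l1 l2 : exists2 B : R, 1 < B &
  forall n, (0 < n)%N -> rnorm (l1 ^+ n - 1) * rnorm (l2 ^+ n - 1) <= B ^+ n.
Proof.
have pow (q : R) n : 0 <= q -> q ^+ n.+1 + 1 <= (q + 1) ^+ n.+1.
  move=> q0; elim: n => [|n IH]; first by rewrite !expr1.
  rewrite [in leRHS]exprS [in leLHS]exprS.
  have : 0 <= q ^+ n.+1 by exact: exprn_ge0.
  nra.
set q1 := modulus l1; set q2 := modulus l2.
have q10 : 0 <= q1 := modulus_ge0 _; have q20 : 0 <= q2 := modulus_ge0 _.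
(* The summand 1 makes the base exceed 1 even when both moduli are 0. *)
exists (((q1 + 1) * (q2 + 1)) ^+ 2 + 1).
  by rewrite ltrDr exprn_gt0 // mulr_gt0 // ltr_wpDl.
case=> // n _.
have b l : rnorm (l ^+ n.+1 - 1) <= ((modulus l + 1) ^+ n.+1) ^+ 2.
  apply: le_trans (rnorm_sub1_le _) _; rewrite modulusX.
  rewrite lerXn2r ?nnegrE ?pow ?modulus_ge0 //.
    by rewrite addr_ge0 // exprn_ge0 // modulus_ge0.
  by rewrite exprn_ge0 // addr_ge0 // modulus_ge0.
apply: (@le_trans _ _ ((((q1 + 1) * (q2 + 1)) ^+ 2) ^+ n.+1)).
  rewrite -exprM mulnC exprM !exprMn.
  by apply: ler_pM; rewrite ?rnorm_ge0 // b.
rewrite lerXn2r ?nnegrE ?sqr_ge0 ?lerDl //.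
by rewrite addr_ge0 // sqr_ge0.
Qed.

End Growth.

(** * The three behaviours *)

Section Trichotomy.
Local Open Scope classical_set_scope.
Local Open Scope complex_scope.
Variable R : realType.
Local Notation C := R[i].
Variables (u : nat -> nat) (l1 l2 : C).
Hypothesis uE : forall n, (u n)%:R = rnorm (l1 ^+ n - 1) * rnorm (l2 ^+ n - 1) :> R.

Lemma hyperbolic_exp_growth : 1 < modulus l1 -> modulus l2 != 1 -> exp_growth R u.
Proof.
move=> q1 q2; have [e e0 he] := rnorm_exp_sub1_gap q2.
have [N hN] := exp_lower_bound l2 q1 e0; have [B B1 hB] := exp_upper_bound l1 l2.
exists (modulus l1), B; split=> //; exists N.+1 => n hn.
have n0 : (0 < n)%N by exact: leq_ltn_trans hn.
by rewrite uE hB // hN ?he // ltnW.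
Qed.

(** If r is the order of l1, the first factor vanishes exactly on the multiples
    of r and is bounded away from 0 elsewhere, by periodicity.  On the multiples
    of r, where the count is 0, h is set to 2^n so as to grow. *)
Lemma root_of_unity_off_multiples : l1 ^+ 12 = 1 -> l1 != 1 -> 1 < modulus l2 ->
  exp_growth_off_multiples R u.
Proof.
move=> l12 l1n q2; have [r rP _] := prim_order_exists (isT : 0 < 12)%N l12.
have r1 n : (r %| n)%N = (l1 ^+ n == 1) by exact: (prim_order_dvd rP).
have r0 := prim_order_gt0 rP.
have [e e0 he] := finite_min r (fun k => rnorm_ge0 (l1 ^+ k - 1)).
have gap n : ~~ (r %| n)%N -> e <= rnorm (l1 ^+ n - 1).
  move=> rn; rewrite -(prim_expr_mod rP n); apply: he; first exact: ltn_pmod.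
  by rewrite rnorm_eq0 subr_eq0 (prim_expr_mod rP) -r1.
have [N hN] := exp_lower_bound l1 q2 e0; have [B B1 hB] := exp_upper_bound l1 l2.
exists r, (fun n => if (r %| n)%N then (2 ^ n)%N else u n); split.
- case: r r0 rP {r1 he gap} => [|[|r]] // _ /prim_expr_order.
  by rewrite expr1 => e1; rewrite e1 eqxx in l1n.
- exists (Num.min 2 (modulus l2)), (Num.max 2 B); split.
  + by rewrite lt_min q2 ltr1n.
  + by rewrite lt_max ltr1n.
  exists N.+1 => n hn; have n0 : (0 < n)%N by exact: leq_ltn_trans hn.
  have m0 : 0 <= Num.min 2 (modulus l2) by rewrite le_min ler0n modulus_ge0.
  have M0 : 0 <= Num.max 2 B by rewrite le_max ler0n.
  have B0 : 0 <= B by rewrite ltW // (lt_trans ltr01).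
  case: ifP => [_|/negbT rn].
    by rewrite natrX; split; apply: lerXn2r; rewrite ?nnegrE ?ler0n // ?ge_min ?le_max lexx.
  rewrite uE; split.
    apply: (@le_trans _ _ (modulus l2 ^+ n)).
      by apply: lerXn2r; rewrite ?nnegrE ?modulus_ge0 // ge_min lexx orbT.
    by rewrite mulrC; apply: hN; [exact: ltnW|exact: gap].
  apply: le_trans (hB n n0) _.
  by apply: lerXn2r; rewrite ?nnegrE // le_max lexx orbT.
- move=> n n0; case: (boolP (r %| n)%N) => // rn.
  apply/eqP; rewrite -(eqr_nat R) uE.
  by move: rn; rewrite r1 => /eqP ->; rewrite subrr /rnorm /= expr0n /= addr0 mul0r.
Qed.

Lemma fixed_eigenvalue_zero n : l1 = 1 -> u n = 0%N.
Proof.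
move=> l11; apply/eqP; rewrite -(eqr_nat R) uE l11 expr1n subrr.
by rewrite /rnorm /= expr0n /= addr0 mul0r.
Qed.

Lemma torsion_periodic k : (0 < k)%N -> nonzero_torsion k l1 l2 -> periodic_sequence u.
Proof.
move=> k0 h; exists k => // n n0; apply/eqP; rewrite -(eqr_nat R) !uE.
have key l : l \in [:: l1; l2] -> l ^+ (n + k) = l ^+ n.
  move=> hl; have [->|l0] := eqVneq l 0.
    by rewrite !expr0n addn_eq0 eqn0Ngt n0.
  by rewrite exprD h // mulr1.
by rewrite !key ?inE ?eqxx ?orbT.
Qed.

End Trichotomy.

Section Behaviours.
Local Open Scope classical_set_scope.
Local Open Scope complex_scope.
Variable R : realType.
Local Notation C := R[i].

Definition eigenvalue_constraints (u : nat -> nat) (l1 l2 : C) : Prop :=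
  [/\ exp_growth R u -> `|l1| != 1 /\ `|l2| != 1,
      periodic_sequence u ->
        (exists2 k : nat, k \in [:: 1; 2; 3; 4; 5; 6; 8; 10; 12]%N &
           forall l : C, l \in [:: l1; l2] -> l != 0 -> k.-unity_root l) \/
        (l1 = 1 /\ 1 < `|l2|) \/ (l2 = 1 /\ 1 < `|l1|) &
      exp_growth_off_multiples R u ->
        (1 < `|l1| /\ is_root_of_unity l2) \/
        (1 < `|l2| /\ is_root_of_unity l1)].

Lemma eigenvalue_constraintsC u (l1 l2 : C) :
  eigenvalue_constraints u l1 l2 -> eigenvalue_constraints u l2 l1.
Proof.
move=> [h1 h2 h3]; split.
- by move=> /h1[].
- move=> /h2[[k hk h]|[h|h]]; [left|right; right|right; left] => //.
  by exists k => // l lP; apply: h; move: lP; rewrite !inE orbC.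
- by move=> /h3[h|h]; [right|left].
Qed.

Definition trichotomy (u : nat -> nat) : Prop :=
  [\/ exp_growth R u, periodic_sequence u | exp_growth_off_multiples R u].

Lemma modulus_neq1 (l : C) : (`|l| != 1) = (modulus l != 1).
Proof. by rewrite modulusE -(rmorph1 (real_complex R)) (inj_eq (@complexI _)). Qed.

Lemma one_lt_modulus (l : C) : (1 < `|l|) = (1 < modulus l).
Proof. by rewrite modulusE ltcR. Qed.

Lemma hyperbolic_behaviour u (l1 l2 : C) :
  (forall n, (u n)%:R = rnorm (l1 ^+ n - 1) * rnorm (l2 ^+ n - 1) :> R) ->
  1 < modulus l1 -> modulus l2 != 1 -> trichotomy u /\ eigenvalue_constraints u l1 l2.
Proof.
move=> uE q1 q2; have g := hyperbolic_exp_growth uE q1 q2; split.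
  exact: Or31.
split; first by move=> _; rewrite !modulus_neq1 q2 gt_eqF.
- by move=> /(exp_growth_not_periodic g).
- by move=> /(exp_growth_not_off_multiples g).
Qed.

(** The eigenvalue l1 = 1 makes every count 0, a periodic function although l2
    is expanding. *)
Lemma mixed_behaviour u (l1 l2 : C) :
  (forall n, (u n)%:R = rnorm (l1 ^+ n - 1) * rnorm (l2 ^+ n - 1) :> R) ->
  l1 ^+ 12 = 1 -> 1 < modulus l2 -> trichotomy u /\ eigenvalue_constraints u l1 l2.
Proof.
move=> uE l12 q2.
have r1 : is_root_of_unity l1 by exists 12%N => //; apply/unity_rootP.
have [l11|l11] := eqVneq l1 1.
  have u0 n : u n = 0%N := fixed_eigenvalue_zero uE n l11.
  have up : periodic_sequence u by exists 1%N => // n _; rewrite !u0.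
  split; first exact: Or32.
  split.
  - by move=> /exp_growth_not_periodic.
  - by move=> _; right; left; rewrite one_lt_modulus.
  - by move=> _; right; rewrite one_lt_modulus.
have g := root_of_unity_off_multiples uE l12 l11 q2.
split; first exact: Or33.
split.
- by move=> /exp_growth_not_off_multiples.
- by move=> /(off_multiples_not_periodic g).
- by move=> _; right; rewrite one_lt_modulus.
Qed.

Lemma torsion_behaviour u (l1 l2 : C) k :
  (forall n, (u n)%:R = rnorm (l1 ^+ n - 1) * rnorm (l2 ^+ n - 1) :> R) ->
  k \in orders -> nonzero_torsion k l1 l2 -> trichotomy u /\ eigenvalue_constraints u l1 l2.
Proof.
move=> uE hk h.
have k0 : (0 < k)%N by case: k hk {h}.
have up := torsion_periodic uE k0 h.
split; first exact: Or32.
split.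
- by move=> /exp_growth_not_periodic.
- by move=> _; left; exists k => // l hl l0; apply/unity_rootP; exact: h.
- by move=> /off_multiples_not_periodic.
Qed.

Lemma eigenvalue_behaviour (u : nat -> nat) (l1 l2 : C) :
  (forall n, (u n)%:R = rnorm (l1 ^+ n - 1) * rnorm (l2 ^+ n - 1) :> R) ->
  eigenvalue_type l1 l2 -> trichotomy u /\ eigenvalue_constraints u l1 l2.
Proof.
move=> uE t.
have uE' n : (u n)%:R = rnorm (l2 ^+ n - 1) * rnorm (l1 ^+ n - 1) :> R.
  by rewrite uE mulrC.
case: t => [n1 n2 /orP[g|g]|r g|g r|k hk h].
- by apply: hyperbolic_behaviour; rewrite ?modulus_gt1 ?modulus_eq1.
- have [] := @hyperbolic_behaviour u l2 l1 uE'; rewrite ?modulus_gt1 ?modulus_eq1 //.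
  by move=> s /eigenvalue_constraintsC.
- by apply: mixed_behaviour; rewrite ?modulus_gt1.
- have [] := @mixed_behaviour u l2 l1 uE' r; rewrite ?modulus_gt1 //.
  by move=> s /eigenvalue_constraintsC.
- exact: torsion_behaviour h.
Qed.

Lemma eigenvalues_exist (X : complex_torus R) (f : X -> X) :
  exists l1 l2 : C, eigenvalues f l1 l2.
Proof.
have [r e] := closed_field_poly_normal (char_poly (rho_a f)).
have m := char_poly_monic (rho_a f); move: e.
rewrite (monicP m) scale1r => e.
have := size_char_poly (rho_a f); rewrite e size_prod_XsubC => -[].
case: r e => [|x [|y [|]]] //= e _; exists x, y.
by rewrite /eigenvalues e !big_cons big_nil mulr1.
Qed.

Lemma fixed_point_behaviour (X : complex_torus R) (f : {additive X -> X}) :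
  holomorphic f ->
  trichotomy (fun n => nfix (iter n f)) /\
  forall l1 l2 : C, eigenvalues f l1 l2 ->
    eigenvalue_constraints (fun n => nfix (iter n f)) l1 l2.
Proof.
move=> hf.
have key l1 l2 : eigenvalues f l1 l2 -> trichotomy (fun n => nfix (iter n f)) /\
    eigenvalue_constraints (fun n => nfix (iter n f)) l1 l2.
  move=> ev; have [a [b [c [e [ha hb hc he]]]]] := eigenvalues_integrality hf ev.
  apply: eigenvalue_behaviour; last exact: classify_eigenvalues ha hb hc he.
  by move=> n; exact: nfix_iter.
split; last by move=> l1 l2 /key[].
by have [l1 [l2 /key[]]] := eigenvalues_exist f.
Qed.

End Behaviours.

(** * Primitives, and angles modulo a full turn *)

Section RealJacobi.
Local Open Scope classical_set_scope.
Local Open Scope complex_scope.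
Variable R : realType.
Implicit Types x y : R.

Lemma is_derive0_cst_ray (f : R -> R) (a x y : R) :
  (forall z : R, a < z -> is_derive z 1 f 0) -> a < x -> a < y -> f x = f y.
Proof.
move=> df; wlog xy : x y / x <= y.
  by move=> H; have [/H h ? ?|/ltW/H h ? ?] := leP x y; [exact: h|apply/esym/h].
move=> ax ay; apply/eqP; rewrite eq_sym -subr_eq0; apply/eqP.
have [||c _ ->] := @MVT_segment _ f (fun=> 0) x y xy; last by rewrite mul0r.
  by move=> z /itvP zI; apply: df; apply: lt_trans ax _; rewrite zI.
apply: continuous_in_subspaceT => z; rewrite inE /= in_itv /= => /andP[xz _].
have [dz _] := df z (lt_le_trans ax xz).
exact/differentiable_continuous/derivable1_diffP.
Qed.

(** The integral from - n to x is a primitive on the ray from - n only; these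
    local primitives, normalized at 0, agree where they are defined, and at x
    one takes any n beyond |x|. *)
Lemma continuous_has_primitive (g : R -> R) : continuous g ->
  exists2 G : R -> R, G 0 = 0 & forall x : R, is_derive x 1 G (g x).
Proof.
move=> gc; pose P (n : nat) x : R :=
  (\int[lebesgue_measure]_(t in `[- n%:R : R, x]) g t)%R.
have dP n (x : R) : - n%:R < x -> is_derive x 1 (P n) (g x).
  move=> nx; have xu : x < x + 1 by rewrite ltrDl.
  have gi : lebesgue_measure.-integrable `[- n%:R, x + 1] (EFin \o g).
    apply: continuous_compact_integrable; first exact: segment_compact.
    exact: continuous_subspaceT.
  have [dF F'] := continuous_FTC1_closed xu gi nx (gc x).
  by rewrite derive1E in F'; apply: DeriveDef.
pose Q n x := P n x - P n 0.
have dQ n (x : R) : - n%:R < x -> is_derive x 1 (Q n) (g x).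
  move=> nx; rewrite -[g x]subr0; apply: is_deriveB; exact: dP.
pose N x := (Num.trunc `|x|).+1.
have Nx x : `|x| < (N x)%:R by have /andP[] := truncn_itv (normr_ge0 x).
have QE m n (x : R) : (0 < m)%N -> (m <= n)%N -> - m%:R < x -> Q m x = Q n x.
  move=> m0 mn mx; apply/eqP; rewrite -subr_eq0; apply/eqP.
  have d0 (z : R) : - m%:R < z -> is_derive z 1 (fun t => Q m t - Q n t) 0.
    move=> mz; rewrite -[0](subrr (g z)); apply: is_deriveB; apply: dQ => //.
    by apply: le_lt_trans mz; rewrite lerN2 ler_nat.
  rewrite (@is_derive0_cst_ray (fun t => Q m t - Q n t) _ x 0 d0 mx).
    by rewrite /Q !subrr.
  by rewrite oppr_lt0 ltr0n.
exists (fun x => Q (N x) x); first by rewrite /Q subrr.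
move=> x.
have xN : - (N x)%:R < x by rewrite ltrNl; apply: le_lt_trans (Nx x); rewrite -normrN ler_norm.
apply: (@near_eq_is_derive _ _ _ (Q (N x)) _ _ _ _ _ (dQ _ _ xN)).
near=> z.
have zx : - (N x)%:R < z by near: z; exact: lt_nbhsr.
have zN : - (N z)%:R < z by rewrite ltrNl; apply: le_lt_trans (Nx z); rewrite -normrN ler_norm.
by have [h|/ltnW h] := leqP (N x) (N z); [|apply/esym]; apply: QE.
Unshelve. all: by end_near. Qed.

(** The difference of the angles has cosine 1; reduced to [0, 2 pi[ it must be 0
    by injectivity of cos on [0, pi], applied to w or to 2 pi - w. *)
Lemma cos_sin_inj x y : cos x = cos y -> sin x = sin y ->
  exists n : int, x - y = (pi *+ 2) *~ n.
Proof.
move=> cE sE; pose T : R := pi *+ 2.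
have T0 : 0 < T by rewrite mulrn_wgt0 // pi_gt0.
have c1 : cos (x - y) = 1.
  by rewrite cosB cE sE -!expr2 cos2Dsin2.
pose n := Num.floor ((x - y) / T).
have cosz u (k : int) : cos (u + T *~ k) = cos u.
  have per m v := periodicn (@cosD2pi R) m v.
  case: k => k; first by rewrite -pmulrn per.
  by rewrite NegzE mulrNz -pmulrn -[in RHS](subrK (T *+ k.+1) u) per.
exists n; apply/eqP; rewrite -subr_eq0; apply/eqP.
set w := x - y - _.
have cw : cos w = 1 by rewrite /w -mulrNz cosz.
have /andP[n1 n2] := floor_itv ((x - y) / T).
have w0 : 0 <= w by rewrite /w subr_ge0 -mulrzr mulrC -ler_pdivlMr.
have wT : w < T.
  rewrite /w ltrBlDl; rewrite -/n ltr_pdivrMr // intrD mulrDl mul1r in n2.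
  by rewrite -mulrzr mulrC.
have [wp|wp] := leP w pi.
  apply: (@cos_inj R); rewrite ?in_itv /= ?lexx ?pi_ge0 ?w0 ?wp //.
  by rewrite cos0.
exfalso.
have : T - w = 0.
  apply: (@cos_inj R); rewrite ?in_itv /= ?lexx ?pi_ge0 //.
    rewrite subr_ge0 ltW //= lerBlDr /T mulr2n lerD2l; exact: ltW.
  by rewrite cos0 addrC -/(- w + T) /T cosD2pi cosN.
by move=> /eqP; rewrite subr_eq0 gt_eqF.
Qed.

End RealJacobi.

(** * Jacobi elliptic functions on the real line *)

(** The three Jacobi functions of modulus k^2 = 1/2 on the real line, through
    their differential equations, algebraic relations and period, which
    determine them up to a translation of the variable.  For this modulus the
    complementary one is the same, so the same functions serve on both coordinate
    axes of the complex plane. *)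
Record real_jacobi (R : realType) := RealJacobi {
  sn : R -> R;
  cn : R -> R;
  dn : R -> R;
  period : R;
  period_gt0 : 0 < period;
  snD2cn : forall x, sn x ^+ 2 + cn x ^+ 2 = 1;
  dn2 : forall x, dn x ^+ 2 = 1 - sn x ^+ 2 / 2;
  dn_gt0 : forall x, 0 < dn x;
  is_derive_sn : forall x : R, is_derive x 1 sn (cn x * dn x);
  is_derive_cn : forall x : R, is_derive x 1 cn (- (sn x * dn x));
  is_derive_dn : forall x : R, is_derive x 1 dn (- (sn x * cn x / 2));
  snDp : forall x, sn (x + period) = sn x;
  cnDp : forall x, cn (x + period) = cn x;
  sn_cn_inj : forall x y, sn x = sn y -> cn x = cn y ->
    exists n : int, x - y = period *~ n
}.

(** The amplitude am is the inverse of F, the primitive of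
    1 / sqrt (1 - sin^2 / 2): F grows at least as fast as the identity, so it is
    a bijection.  Then sn = sin am, cn = cos am, and dn = am'.  The period is
    F (2 pi), because the integrand has period 2 pi. *)
Lemma real_jacobi_exists (R : realType) : inhabited (real_jacobi R).
Proof.
pose q (x : R) : R := Num.sqrt (1 - sin x ^+ 2 / 2).
have q2 x : q x ^+ 2 = 1 - sin x ^+ 2 / 2.
  by rewrite sqr_sqrtr //; have := cos2Dsin2 x; nra.
have arg_gt0 (x : R) : 0 < 1 - sin x ^+ 2 / 2 by have := cos2Dsin2 x; nra.
have q0 x : 0 < q x by rewrite sqrtr_gt0.
have q1 x : q x <= 1 by have := q2 x; have := q0 x; have := sqr_ge0 (sin x); nra.
have dq (x : R) : is_derive x 1 q (- (sin x * cos x / 2) / q x).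
  have ds : is_derive x 1 (fun x : R => 1 - sin x ^+ 2 / 2) (- (sin x * cos x)).
    apply: is_derive_eq; by rewrite /GRing.scale /=; field.
  have := @is_derive1_comp _ Num.sqrt _ x _ _ (is_derive1_sqrt (arg_gt0 x)) ds.
  rewrite -/(q x) => h; apply: (is_derive_eq h).
  by field; rewrite gt_eqF.
pose g x := (q x)^-1.
have g0 x : 0 < g x by rewrite invr_gt0.
have g1 x : 1 <= g x by rewrite invf_ge1.
have gc : continuous g.
  move=> x; apply: continuousV; first by rewrite gt_eqF.
  by have [h _] := dq x; exact/differentiable_continuous/derivable1_diffP.
have [F F0 dF] := continuous_has_primitive gc.
have Fc : continuous F.
  by move=> x; have [h _] := dF x; exact/differentiable_continuous/derivable1_diffP.
have Fle x y : x <= y -> y - x <= F y - F x.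
  move=> xy; have [|c _ ->] := @MVT_segment _ F g x y xy.
    exact: continuous_subspaceT.
  by rewrite ler_peMl // subr_ge0.
have Finj : injective F.
  move=> x y e; apply/eqP; rewrite eq_le.
  case/orP: (le_total x y) => h; rewrite h ?andbT /=; have := Fle _ _ h;
    by rewrite e subrr subr_le0.
have Fsurj (v : R) : exists x : R, F x = v.
  have ab : - `|v| <= `|v| by rewrite (le_trans (_ : _ <= 0)) // oppr_le0.
  have h1 : `|v| <= F `|v| by have := Fle _ _ (normr_ge0 v); rewrite F0 !subr0.
  have h2 : F (- `|v|) <= - `|v|.
    have : - `|v| <= 0 by rewrite oppr_le0.
    by move=> /Fle; rewrite F0 !sub0r opprK lerNr.
  have [||x _ e] := @IVT _ F (- `|v|) (`|v|) v ab; last by exists x.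
    exact: continuous_subspaceT.
  rewrite ge_min le_max; apply/andP; split; apply/orP.
    by left; apply: le_trans h2 _; rewrite lerNl -normrN ler_norm.
  by right; apply: le_trans h1; rewrite ler_norm.
pose am (v : R) : R := projT1 (cid (Fsurj v)).
have Fam v : F (am v) = v by rewrite /am; case: cid.
have amF x : am (F x) = x by apply: Finj; rewrite Fam.
have dam (v : R) : is_derive v 1 am (q (am v)).
  rewrite -[q _]invrK -{1}(Fam v); apply: (@is_derive_inverse _ F am).
  - by near=> z; exact: amF.
  - by near=> z; exact: Fc.
  - by rewrite invr_eq0 gt_eqF.
pose T : R := F (pi *+ 2).
have FT x : F (x + pi *+ 2) = F x + T.
  have dz (z : R) : is_derive z 1 (fun x => F (x + pi *+ 2) - F x) 0.
    have ds : is_derive z 1 (fun x : R => x + pi *+ 2) 1.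
      by apply: is_derive_eq; rewrite addr0.
    have h := @is_derive1_comp _ F _ z _ _ (dF (z + pi *+ 2)) ds.
    have -> : 0 = g (z + pi *+ 2) * 1 - g z by rewrite /g /q sinD2pi mulr1 subrr.
    exact: is_deriveB.
  have := is_derive_0_is_cst x 0 dz; rewrite /= add0r F0 subr0 => /eqP.
  by rewrite subr_eq [T + _]addrC => /eqP.
have T0 : 0 < T.
  have p0 : 0 < (pi : R) *+ 2 by rewrite mulrn_wgt0 // pi_gt0.
  by have := Fle _ _ (ltW p0); rewrite F0 !subr0; apply: lt_le_trans.
have amT v : am (v + T) = am v + pi *+ 2 by apply: Finj; rewrite FT !Fam.
have FTz x (n : int) : F (x + (pi *+ 2) *~ n) = F x + T *~ n.
  have FTn m y : F (y + (pi *+ 2) *+ m) = F y + T *+ m.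
    elim: m y => [|m IH] y; first by rewrite !addr0.
    by rewrite 2!(mulrSr _ m) (addrA y) FT IH addrA.
  case: n => n; first by rewrite -!pmulrn FTn.
  rewrite NegzE !mulrNz -!pmulrn; apply/eqP; rewrite eq_sym subr_eq.
  by rewrite -FTn subrK.
have dsn (v : R) : is_derive v 1 (fun v => sin (am v)) (cos (am v) * q (am v)).
  exact: (@is_derive1_comp _ sin am).
have dcn (v : R) : is_derive v 1 (fun v => cos (am v)) (- (sin (am v) * q (am v))).
  rewrite -mulNr; exact: (@is_derive1_comp _ cos am).
have ddn (v : R) :
    is_derive v 1 (fun v => q (am v)) (- (sin (am v) * cos (am v) / 2)).
  have := @is_derive1_comp _ q am v _ _ (dq _) (dam v).
  by rewrite divfK ?gt_eqF.
constructor; apply: (@RealJacobi R _ _ _ T T0 _ _ _ dsn dcn ddn) => //.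
- by move=> x; rewrite addrC cos2Dsin2.
- by move=> x; rewrite amT sinD2pi.
- by move=> x; rewrite amT cosD2pi.
- move=> x y sE cE; have [n /eqP] := cos_sin_inj cE sE.
  rewrite subr_eq addrC => /eqP e; exists n.
  by rewrite -[x]Fam e FTz Fam addrC addKr.
Unshelve. all: by end_near. Qed.

(** * Cauchy-Riemann equations *)

Section RealGradient.
Local Open Scope classical_set_scope.
Local Open Scope complex_scope.
Variable R : realType.
Local Notation C := R[i].
Implicit Types (p q : C -> R) (z w : C).

Lemma Re_continuous : continuous (Re : C -> R).
Proof.
move=> z; apply: (@cvgrPdist_lt _ _ _ (nbhs z) _ _ _).2 => e e0.
have e0' : 0 < e%:C by rewrite ltcR.
have zw : \forall w \near z, `|z - w| < e%:C 
  by apply: (@cvgr_dist_lt _ _ _ (nbhs z) _ id z (@cvg_id _ _) _ e0').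
apply: filterS zw => w.
rewrite -ltcR; apply: le_lt_trans; apply: le_trans (normc_ge_Re _).
by case: z w {e0'} => [? ?] [? ?].
Unshelve. all: by end_near. Qed.

Lemma normc_le_ReIm z : `|z| <= (`|Re z| + `|Im z|)%:C.
Proof.
rewrite normc_def lecR -[leRHS]ger0_norm ?addr_ge0 // -sqrtr_sqr ler_wsqrtr //.
have := normr_ge0 (Re z); have := normr_ge0 (Im z).
have := real_normK (num_real (Re z)); have := real_normK (num_real (Im z)).
nra.
Qed.

Lemma normc_ge_Im z : `|Im z|%:C <= `|z|.
Proof.
by rewrite normc_def lecR -sqrtr_sqr ler_wsqrtr // lerDr sqr_ge0.
Qed.

Lemma Im_continuous : continuous (Im : C -> R).
Proof.
move=> z; apply: (@cvgrPdist_lt _ _ _ (nbhs z) _ _ _).2 => e e0.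
have e0' : 0 < e%:C by rewrite ltcR.
have zw : \forall w \near z, `|z - w| < e%:C 
  by apply: (@cvgr_dist_lt _ _ _ (nbhs z) _ id z (@cvg_id _ _) _ e0').
apply: filterS zw => w.
rewrite -ltcR; apply: le_lt_trans; apply: le_trans (normc_ge_Im _).
by case: z w {e0'} => [? ?] [? ?].
Unshelve. all: by end_near. Qed.

Let cD p q z (a b : R) : p w @[w --> z] --> a -> q w @[w --> z] --> b ->
  (p w + q w) @[w --> z] --> a + b.
Proof. exact: (@cvgD _ _ _ (nbhs z)). Qed.

Let cN p z (a : R) : p w @[w --> z] --> a -> (- p w) @[w --> z] --> - a.
Proof. exact: (@cvgN _ _ _ (nbhs z)). Qed.

Let cM p q z (a b : R) : p w @[w --> z] --> a -> q w @[w --> z] --> b ->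
  (p w * q w) @[w --> z] --> a * b.
Proof. exact: (@cvgM _ _ (nbhs z)). Qed.

Let cV p z (a : R) : a != 0 -> p w @[w --> z] --> a ->
  (p w)^-1 @[w --> z] --> a^-1.
Proof. by move=> a0; apply: (@cvgV _ _ (nbhs z)). Qed.

Let cC z (a : R) : (fun=> a) w @[w --> z] --> a.
Proof. exact: (@cvg_cst _ a _ (nbhs z)). Qed.

(** Total differentiability of a real function on the plane, in Caratheodory's
    form: the increment is a combination of the increments of the coordinates
    with coefficients tending to the partial derivatives a and b.  In this form
    the rules of calculus are identities between increments. *)
Definition has_grad p z (a b : R) : Prop :=
  exists A B : C -> R, [/\ A w @[w --> z] --> a, B w @[w --> z] --> b &
    \forall w \near z,
      p w - p z = A w * (Re w - Re z) + B w * (Im w - Im z)].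

Lemma has_grad_cvg p z a b : has_grad p z a b -> p w @[w --> z] --> p z.
Proof.
move=> [A [B [cA cB E]]].
have r0 := cD (@Re_continuous z) (@cC z (- Re z)).
have i0 := cD (@Im_continuous z) (@cC z (- Im z)).
have h := cD (@cC z (p z)) (cD (cM cA r0) (cM cB i0)).
rewrite !subrr !mulr0 !addr0 in h;
move=> P /h hP; change (\forall w \near z, P (p w)).
by apply: filterS2 E hP => w e /=; rewrite -e addrC subrK.
Qed.

Lemma has_grad_Re (s : R -> R) z (a : R) :
  is_derive (Re z) 1 s a -> has_grad (fun w => s (Re w)) z a 0.
Proof.
move=> /is_derive1_caratheodory[g [gE gc ga]].
exists (fun w => g (Re w)), (fun=> 0); split; last 1 first.
- by near=> w; rewrite gE mul0r addr0.
- by rewrite -ga; apply: (@continuous_comp _ _ _ Re g); [exact: Re_continuous|].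
- exact: cC.
Unshelve. all: by end_near. Qed.

Lemma has_grad_Im (s : R -> R) z (b : R) :
  is_derive (Im z) 1 s b -> has_grad (fun w => s (Im w)) z 0 b.
Proof.
move=> /is_derive1_caratheodory[g [gE gc ga]].
exists (fun=> 0), (fun w => g (Im w)); split; last 1 first.
- by near=> w; rewrite gE mul0r add0r.
- exact: cC.
- by rewrite -ga; apply: (@continuous_comp _ _ _ Im g); [exact: Im_continuous|].
Unshelve. all: by end_near. Qed.

Lemma has_grad_cst (k : R) z : has_grad (fun=> k) z 0 0.
Proof.
exists (fun=> 0), (fun=> 0); split; [exact: cC..|].
by near=> w; rewrite subrr !mul0r addr0.
Unshelve. all: by end_near. Qed.

Lemma has_gradD p q z a b a' b' : has_grad p z a b -> has_grad q z a' b' ->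
  has_grad (fun w => p w + q w) z (a + a') (b + b').
Proof.
move=> [A [B [cA cB E]]] [A' [B' [cA' cB' E']]].
exists (fun w => A w + A' w), (fun w => B w + B' w).
split; [exact: cD|exact: cD|].
apply: filterS2 E E' => w e e'.
by rewrite opprD addrACA e e' //; ring.
Unshelve. all: by end_near. Qed.

Lemma has_gradM p q z a b a' b' : has_grad p z a b -> has_grad q z a' b' ->
  has_grad (fun w => p w * q w) z (a * q z + p z * a') (b * q z + p z * b').
Proof.
move=> pg qg; have qc := has_grad_cvg qg.
move: pg qg => [A [B [cA cB E]]] [A' [B' [cA' cB' E']]].
exists (fun w => A w * q w + p z * A' w), (fun w => B w * q w + p z * B' w).
split; [by apply: cD; apply: cM => //; exact: cC..|].
apply: filterS2 E E' => w e e'.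
have -> : p w * q w - p z * q z = (p w - p z) * q w + p z * (q w - q z) by ring.
by rewrite e e'; ring.
Unshelve. all: by end_near. Qed.

Lemma has_gradN p z a b : has_grad p z a b -> has_grad (fun w => - p w) z (- a) (- b).
Proof.
move=> [A [B [cA cB E]]].
exists (fun w => - A w), (fun w => - B w); split; [exact: cN..|].
apply: filterS E => w e.
by rewrite -opprD e; ring.
Unshelve. all: by end_near. Qed.

Lemma has_gradV p z a b : p z != 0 -> has_grad p z a b ->
  has_grad (fun w => (p w)^-1) z (- a / p z ^+ 2) (- b / p z ^+ 2).
Proof.
move=> p0 pg; have pc := has_grad_cvg pg.
move: pg => [A [B [cA cB E]]].
have ic : (p w * p z)^-1 @[w --> z] --> (p z ^+ 2)^-1.
  rewrite expr2; apply: cV; first by rewrite mulf_neq0.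
  by apply: cM => //; exact: cC.
exists (fun w => - A w / (p w * p z)), (fun w => - B w / (p w * p z)).
split; [by apply: cM => //; exact: cN..|].
have p0n : \forall w \near z, p w != 0.
  exact: (@cvgr_neq0 _ _ _ (nbhs z) _ p (p z) pc p0).
apply: filterS2 E p0n => w e pw.
have -> : (p w)^-1 - (p z)^-1 = - (p w - p z) / (p w * p z).
  by field; rewrite pw p0.
by rewrite e; ring.
Unshelve. all: by end_near. Qed.

Lemma has_grad_eq p z a b a' b' : has_grad p z a b -> a = a' -> b = b' ->
  has_grad p z a' b'.
Proof. by move=> + <- <-. Qed.

(** With partial derivatives (a, b) and (- b, a), the increment of p + i q minus
    (a - i b) h is a combination of the coordinates of h with coefficients that
    tend to 0, and these coordinates are bounded by |h|. *)
Lemma cauchy_riemann p q z a b : has_grad p z a b -> has_grad q z (- b) a ->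
  is_derive z (1 : C) (fun w => p w +i* q w) (a +i* - b).
Proof.
move=> [A [B [cA cB E]]] [A' [B' [cA' cB' E']]].
set f := fun w => _.
have H : (fun h => h^-1 *: ((f \o shift z) (h *: 1) - f z)) @ (0 : C)^' --> a +i* - b.
  apply: (@cvgrPdist_lt _ _ _ ((0 : C)^') _ _ _).2 => e e0.
  have eE : e = (Re e)%:C by rewrite RRe_real // gtr0_real.
  (* One quarter for each of the coefficients A, B, A', B'. *)
  have e4 : 0 < Re e / 4 by rewrite divr_gt0 // -ltcR -eE.
  have sh (P : C -> Prop) : (\forall w \near z, P w) ->
      \forall h \near (0 : C)^', P (h + z).
    move=> Pz; apply: nbhs_dnbhs.
    have c0 : (h + z) @[h --> (0 : C)] --> (0 : C) + z.
      apply: (@continuousD _ _ _ (fun h => h) (fun=> z)) => //.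
      exact: cst_continuous.
    by rewrite add0r in c0; exact: c0 Pz.
  have cvgE (F : C -> R) l : F w @[w --> z] --> l ->
      \forall h \near (0 : C)^', `|F (h + z) - l| < Re e / 4.
    move=> cF; have cl : \forall w \near z, `|l - F w| < Re e / 4.
      exact: (@cvgrPdist_lt _ _ _ (nbhs z) _ F l).1 cF _ e4.
    by have := sh _ cl; apply: filterS => h; rewrite distrC.
  have FI (P Q : C -> Prop) : (\forall h \near (0 : C)^', P h) ->
      (\forall h \near (0 : C)^', Q h) -> \forall h \near (0 : C)^', P h /\ Q h.
    exact: (@filterI C ((0 : C)^')).
  have near1 := FI _ _ (cvgE _ _ cA) (cvgE _ _ cB).
  have near2 := FI _ _ (cvgE _ _ cA') (cvgE _ _ cB').
  have near3 := FI _ _ (sh _ E) (sh _ E').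
  have near0 : \forall h \near (0 : C)^', h != 0 by exact: nbhs_dnbhs_neq.
  have near4 := FI _ _ (FI _ _ near1 near2) (FI _ _ near3 near0).
  apply: filterS near4 => h [[[hA hB] [hA' hB']] [[hE hE'] h0]].
  have h1 : h *: (1 : C) = h by exact: mulr1.
  have -> : (f \o shift z) (h *: 1) = f (h + z) by rewrite h1.
  have zh : Re (h + z) - Re z = Re h /\ Im (h + z) - Im z = Im h.
    by case: (h) (z) => [? ?] [? ?] /=; rewrite !addrK.
  rewrite zh.1 zh.2 in hE hE'.
  have fE : f (h + z) - f z = (A (h + z) * Re h + B (h + z) * Im h)
      +i* (A' (h + z) * Re h + B' (h + z) * Im h).
    by rewrite -hE -hE'.
  rewrite fE; move: hA hB hA' hB'.
  move: (A _) (B _) (A' _) (B' _) => x1 x2 y1 y2 hA hB hA' hB'.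
  set u := Re h; set v := Im h.
  have -> : a +i* - b - h^-1 *: ((x1 * u + x2 * v) +i* (y1 * u + y2 * v)) =
      - h^-1 * (((x1 - a) * u + (x2 - b) * v) +i* ((y1 - - b) * u + (y2 - a) * v)).
    move Pe: (x1 * u + x2 * v) => P; move Qe: (y1 * u + y2 * v) => Q.
    apply: (mulfI h0); rewrite mulrBr [_ *: _]/(h^-1 * _).
    rewrite [h * (h^-1 * _)]mulrA [h * (- h^-1 * _)]mulrA mulrN divff //.
    rewrite mul1r mulN1r.
    rewrite [in LHS](_ : h = u +i* v); last by rewrite /u /v; case: (h).
    apply/eqP; rewrite eq_complex /=; apply/andP; split; apply/eqP; rewrite -?Pe -?Qe; ring.
  rewrite normrM normrN normfV mulrC ltr_pdivrMr ?normr_gt0 //.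
  apply: le_lt_trans (normc_le_ReIm _) _ => /=.
  set k := Re `|h|.
  have kE : `|h| = k%:C by rewrite /k RRe_real // ger0_real.
  have k0 : 0 < k by rewrite -ltcR -kE normr_gt0.
  have uk : `|u| <= k by rewrite -lecR -kE; exact: normc_ge_Re.
  have vk : `|v| <= k by rewrite -lecR -kE; exact: normc_ge_Im.
  rewrite kE eE -rmorphM ltcR.
  have T (x t : R) : `|x| < Re e / 4 -> `|t| <= k -> `|x * t| <= Re e / 4 * k.
    by move=> hx ht; rewrite normrM ler_pM // ltW.
  have ltT (x t : R) : `|x| < Re e / 4 -> `|t| <= k -> `|x * t| < Re e / 4 * k.
    move=> hx ht; rewrite normrM; apply: (@le_lt_trans _ _ (`|x| * k)).
      by rewrite ler_wpM2l.
    by rewrite ltr_pM2r.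
  have n1 := ler_normD ((x1 - a) * u) ((x2 - b) * v).
  have n2 := ler_normD ((y1 - - b) * u) ((y2 - a) * v).
  have := ltT _ _ hA uk; have := T _ _ hB vk.
  have := T _ _ hA' uk; have := T _ _ hB' vk.
  move: n1 n2; clear; move: (Re e) => r; move=> *; lra.
by constructor; [apply/cvg_ex; exists (a +i* - b)|exact: cvg_lim H].
Qed.
End RealGradient.

(** * Jacobi elliptic functions on the complex plane *)

Section ComplexJacobi.
Local Open Scope classical_set_scope.
Local Open Scope complex_scope.
Variables (R : realType) (J : real_jacobi R).
Local Notation C := R[i].
Implicit Types (z w : C).

Local Notation s z := (sn J (Re z)).
Local Notation c z := (cn J (Re z)).
Local Notation d z := (dn J (Re z)).
Local Notation s1 z := (sn J (Im z)).
Local Notation c1 z := (cn J (Im z)).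
Local Notation d1 z := (dn J (Im z)).

(** Jacobi's formulas for sn, cn, dn at x + i y, with s, c, d the values of the
    real functions at x and s1, c1, d1 those at y.  The common denominator of the
    first three is the first one below, and vanishes exactly at the poles.  The
    quotients ns = 1 / sn, cs = cn / sn, ds = dn / sn, rewritten by the other
    addition formulas so as to be regular at the poles, have the second one. *)
Definition finite_den z := 1 - d z ^+ 2 * s1 z ^+ 2.
Definition pole_den z := s z ^+ 2 * c1 z ^+ 2 + s1 z ^+ 2.

Definition snC z : C :=
  (s z * d1 z / finite_den z) +i* (c z * d z * s1 z * c1 z / finite_den z).
Definition cnC z : C :=
  (c z * c1 z / finite_den z) +i* - (s z * d z * s1 z * d1 z / finite_den z).
Definition dnC z : C :=
  (d z * c1 z * d1 z / finite_den z) +i* - (s z * c z * s1 z / 2 / finite_den z).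

Definition nsC z : C :=
  (s z * d1 z / pole_den z) +i* - (c z * d z * s1 z * c1 z / pole_den z).
Definition csC z : C :=
  (s z * c z * c1 z * d1 z / pole_den z) +i* - (s1 z * d z / pole_den z).
Definition dsC z : C :=
  (s z * d z * c1 z / pole_den z) +i* - (c z * s1 z * d1 z / pole_den z).


(** Eliminating sn and cn in favour of dn keeps the coefficients integral, as
    needed for [field] to use these equations as rewriting rules. *)
Lemma sn2_dn x : sn J x ^+ 2 = 2 - 2 * dn J x ^+ 2.
Proof. by rewrite dn2; field. Qed.
Lemma cn2_dn x : cn J x ^+ 2 = 2 * dn J x ^+ 2 - 1.
Proof. by have := snD2cn J x; rewrite sn2_dn => /(canRL (addKr _)) ->; ring. Qed.

Lemma dn_neq0 x : dn J x != 0.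
Proof. by rewrite gt_eqF // dn_gt0. Qed.

Lemma sn_neq0 x : cn J x = 0 -> sn J x != 0.
Proof.
move=> c0; apply/eqP => s0; have := snD2cn J x.
by rewrite s0 c0 expr0n addr0 => /esym/eqP; rewrite oner_eq0.
Qed.

Lemma cn_neq0 x : sn J x = 0 -> cn J x != 0.
Proof. by apply: contra_eq_neq => /sn_neq0. Qed.

Lemma finite_denE z : finite_den z = 1 - 2 * d z ^+ 2 + 2 * d z ^+ 2 * d1 z ^+ 2.
Proof. by rewrite /finite_den sn2_dn; ring. Qed.

Lemma pole_denE z : pole_den z = 2 * d z ^+ 2 + 2 * d1 z ^+ 2 - 4 * d z ^+ 2 * d1 z ^+ 2.
Proof. by rewrite /pole_den !sn2_dn cn2_dn; ring. Qed.

Lemma finite_den_eq0 z : finite_den z = 0 -> s z = 0 /\ c1 z = 0.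
Proof.
move=> D0; have := sn2_dn (Re z); have := cn2_dn (Im z); have := snD2cn J (Im z).
have : finite_den z = c1 z ^+ 2 + s z ^+ 2 * s1 z ^+ 2 / 2.
  by rewrite finite_denE !sn2_dn cn2_dn; field.
rewrite D0 => e e1 _ _.
have /eqP : c1 z ^+ 2 = 0 by have := sqr_ge0 (s z * s1 z); have := sqr_ge0 (c1 z); nra.
rewrite sqrf_eq0 => /eqP h; split=> //.
move: e e1; rewrite h expr0n /= add0r addr0 => e e1; rewrite e1 mulr1 in e.
have /eqP : s z ^+ 2 = 0 by lra.
by rewrite sqrf_eq0 => /eqP.
Qed.

Lemma pole_den_neq0 z : s z = 0 -> c1 z = 0 -> pole_den z = 1.
Proof.
move=> s0 c0; have := snD2cn J (Im z).
by rewrite /pole_den s0 c0 !expr0n /= mul0r add0r addr0.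
Qed.

Let gs z : has_grad (fun w => s w) z (c z * d z) 0.
Proof. exact: (has_grad_Re (is_derive_sn J _)). Qed.
Let gc z : has_grad (fun w => c w) z (- (s z * d z)) 0.
Proof. exact: (has_grad_Re (is_derive_cn J _)). Qed.
Let gd z : has_grad (fun w => d w) z (- (s z * c z / 2)) 0.
Proof. exact: (has_grad_Re (is_derive_dn J _)). Qed.
Let gs1 z : has_grad (fun w => s1 w) z 0 (c1 z * d1 z).
Proof. exact: (has_grad_Im (is_derive_sn J _)). Qed.
Let gc1 z : has_grad (fun w => c1 w) z 0 (- (s1 z * d1 z)).
Proof. exact: (has_grad_Im (is_derive_cn J _)). Qed.
Let gd1 z : has_grad (fun w => d1 w) z 0 (- (s1 z * c1 z / 2)).
Proof. exact: (has_grad_Im (is_derive_dn J _)). Qed.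

Let gA z : has_grad finite_den z (2 * s z * c z * d z * s1 z ^+ 2 / 2)
  (- (2 * d z ^+ 2 * s1 z * c1 z * d1 z)).
Proof.
apply: (has_grad_eq (has_gradD (has_grad_cst 1 z)
  (has_gradN (has_gradM (has_gradM (gd z) (gd z)) (has_gradM (gs1 z) (gs1 z)))))); by field.
Qed.

Let gB z : has_grad pole_den z (2 * s z * c z * d z * c1 z ^+ 2)
  (2 * s1 z * c1 z * d1 z * (1 - s z ^+ 2)).
Proof.
apply: (has_grad_eq (has_gradD
  (has_gradM (has_gradM (gs z) (gs z)) (has_gradM (gc1 z) (gc1 z)))
  (has_gradM (gs1 z) (gs1 z)))); by ring.
Qed.

Ltac generalize_jacobi z :=
  have := sn2_dn (Re z); have := sn2_dn (Im z);
  have := cn2_dn (Re z); have := cn2_dn (Im z);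
  move: (s z) (c z) (d z) (s1 z) (c1 z) (d1 z) => S0 C0 D0 S1 C1 D1 e1 e2 e3 e4.

Ltac complex_split :=
  apply/eqP; rewrite eq_complex ?expr2 /=; apply/andP; split; apply/eqP.

Lemma snC2DcnC2 z : finite_den z != 0 -> snC z ^+ 2 + cnC z ^+ 2 = 1.
Proof.
rewrite /snC /cnC finite_denE; generalize_jacobi z => H.
by complex_split; field: e1 e2 e3 e4.
Qed.

Lemma snC2DdnC2 z : finite_den z != 0 -> snC z ^+ 2 + (dnC z ^+ 2 + dnC z ^+ 2) = 1 + 1.
Proof.
rewrite /snC /dnC finite_denE; generalize_jacobi z => H.
by complex_split; field: e1 e2 e3 e4.
Qed.

Lemma csC2D1 z : pole_den z != 0 -> csC z ^+ 2 + 1 = nsC z ^+ 2.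
Proof.
rewrite /csC /nsC pole_denE; generalize_jacobi z => H.
by complex_split; field: e1 e2 e3 e4.
Qed.

Lemma dsC2D1 z : pole_den z != 0 -> dsC z ^+ 2 + dsC z ^+ 2 + 1 = nsC z ^+ 2 + nsC z ^+ 2.
Proof.
rewrite /dsC /nsC pole_denE; generalize_jacobi z => H.
by complex_split; field: e1 e2 e3 e4.
Qed.

Lemma snC_nsC z : finite_den z != 0 -> pole_den z != 0 -> snC z * nsC z = 1.
Proof.
rewrite /snC /nsC finite_denE pole_denE; generalize_jacobi z => H H'.
by complex_split; field: e1 e2 e3 e4; apply/andP; split.
Qed.

Lemma snC_csC z : finite_den z != 0 -> pole_den z != 0 -> snC z * csC z = cnC z.
Proof.
rewrite /snC /csC /cnC finite_denE pole_denE; generalize_jacobi z => H H'.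
by complex_split; field: e1 e2 e3 e4; apply/andP; split.
Qed.

Lemma snC_dsC z : finite_den z != 0 -> pole_den z != 0 -> snC z * dsC z = dnC z.
Proof.
rewrite /snC /dsC /dnC finite_denE pole_denE; generalize_jacobi z => H H'.
by complex_split; field: e1 e2 e3 e4; apply/andP; split.
Qed.

Lemma is_derive_of_grads (p q : C -> R) z a b a' b' (l : C) :
  has_grad p z a b -> has_grad q z a' b' ->
  a = Re l -> b = - Im l -> a' = Im l -> b' = Re l ->
  is_derive z (1 : C) (fun w => p w +i* q w) l.
Proof.
move=> gp gq ea eb ea' eb'; have -> : l = a +i* - b.
  by rewrite ea eb opprK; case: (l).
by apply: cauchy_riemann => //; apply: (has_grad_eq gq); rewrite ?eb ?opprK ?ea'
  ?eb' ?ea.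
Qed.

Ltac check_cauchy_riemann z D0 denE gp gq :=
  apply: (is_derive_of_grads gp gq);
  move: D0; rewrite /snC /cnC /dnC /nsC /csC /dsC /= !denE;
  generalize_jacobi z => H.

Lemma is_derive_snC z : finite_den z != 0 -> is_derive z (1 : C) snC (cnC z * dnC z).
Proof.
move=> D0; have gV := has_gradV D0 (gA z).
have gp := has_gradM (has_gradM (gs z) (gd1 z)) gV.
have gq := has_gradM (has_gradM (has_gradM (has_gradM (gc z) (gd z)) (gs1 z))
  (gc1 z)) gV.
by check_cauchy_riemann z D0 finite_denE gp gq; field: e1 e2 e3 e4.
Qed.

Lemma is_derive_cnC z : finite_den z != 0 -> is_derive z (1 : C) cnC (- (snC z * dnC z)).
Proof.
move=> D0; have gV := has_gradV D0 (gA z).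
have gp := has_gradM (has_gradM (gc z) (gc1 z)) gV.
have gq := has_gradN (has_gradM (has_gradM (has_gradM (has_gradM (gs z) (gd z)) (gs1 z))
  (gd1 z)) gV).
by check_cauchy_riemann z D0 finite_denE gp gq; field: e1 e2 e3 e4.
Qed.

Lemma is_derive_dnC z : finite_den z != 0 ->
  is_derive z (1 : C) dnC (- (snC z * cnC z / 2%:C)).
Proof.
move=> D0; have gV := has_gradV D0 (gA z).
have gp := has_gradM (has_gradM (has_gradM (gd z) (gc1 z)) (gd1 z)) gV.
have gq := has_gradN (has_gradM (has_gradM (has_gradM (has_gradM (gs z) (gc z)) (gs1 z))
  (has_grad_cst (2^-1) z)) gV).
by check_cauchy_riemann z D0 finite_denE gp gq; field: e1 e2 e3 e4.
Qed.

Lemma is_derive_nsC z : pole_den z != 0 -> is_derive z (1 : C) nsC (- (csC z * dsC z)).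
Proof.
move=> D0; have gV := has_gradV D0 (gB z).
have gp := has_gradM (has_gradM (gs z) (gd1 z)) gV.
have gq := has_gradN (has_gradM (has_gradM (has_gradM (has_gradM (gc z) (gd z)) (gs1 z))
  (gc1 z)) gV).
by check_cauchy_riemann z D0 pole_denE gp gq; field: e1 e2 e3 e4.
Qed.

Lemma is_derive_csC z : pole_den z != 0 -> is_derive z (1 : C) csC (- (nsC z * dsC z)).
Proof.
move=> D0; have gV := has_gradV D0 (gB z).
have gp := has_gradM (has_gradM (has_gradM (has_gradM (gs z) (gc z)) (gc1 z)) (gd1 z)) gV.
have gq := has_gradN (has_gradM (has_gradM (gs1 z) (gd z)) gV).
by check_cauchy_riemann z D0 pole_denE gp gq; field: e1 e2 e3 e4.
Qed.

Lemma is_derive_dsC z : pole_den z != 0 -> is_derive z (1 : C) dsC (- (nsC z * csC z)).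
Proof.
move=> D0; have gV := has_gradV D0 (gB z).
have gp := has_gradM (has_gradM (has_gradM (gs z) (gd z)) (gc1 z)) gV.
have gq := has_gradN (has_gradM (has_gradM (has_gradM (gc z) (gs1 z)) (gd1 z)) gV).
by check_cauchy_riemann z D0 pole_denE gp gq; field: e1 e2 e3 e4.
Qed.

Lemma finite_den_near z : finite_den z != 0 -> \forall w \near z, finite_den w != 0.
Proof.
exact: (@cvgr_neq0 _ _ _ (nbhs z) _ finite_den (finite_den z) (has_grad_cvg (gA z))).
Qed.

Lemma pole_den_near z : pole_den z != 0 -> \forall w \near z, pole_den w != 0.
Proof.
exact: (@cvgr_neq0 _ _ _ (nbhs z) _ pole_den (pole_den z) (has_grad_cvg (gB z))).
Qed.

(** The sum recovers the denominator from the values of sn and cn; the three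
    norms that follow are then linear in s^2, s1^2 and s^2 s1^2. *)
Lemma norm_snC_cnC z : finite_den z != 0 ->
  1 + (Re (snC z) ^+ 2 + Im (snC z) ^+ 2) + (Re (cnC z) ^+ 2 + Im (cnC z) ^+ 2)
  = 2 / finite_den z.
Proof.
rewrite /snC /cnC /= finite_denE; generalize_jacobi z => H.
by field: e1 e2 e3 e4.
Qed.

Lemma norm_snC z : finite_den z != 0 ->
  Re (snC z) ^+ 2 + Im (snC z) ^+ 2 =
  (s z ^+ 2 + s1 z ^+ 2 - s z ^+ 2 * s1 z ^+ 2) / finite_den z.
Proof.
rewrite /snC /= finite_denE; generalize_jacobi z => H.
by field: e1 e2 e3 e4.
Qed.

Lemma norm_cnC z : finite_den z != 0 ->
  Re (cnC z) ^+ 2 + Im (cnC z) ^+ 2 = (1 - s z ^+ 2 + s z ^+ 2 * s1 z ^+ 2 / 2) / finite_den z.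
Proof.
rewrite /cnC /= finite_denE; generalize_jacobi z => H.
by field: e1 e2 e3 e4.
Qed.

Lemma norm_dnC z : finite_den z != 0 ->
  Re (dnC z) ^+ 2 + Im (dnC z) ^+ 2 = (1 - s z ^+ 2 / 2 - s1 z ^+ 2 / 2) / finite_den z.
Proof.
rewrite /dnC /= finite_denE; generalize_jacobi z => H.
by field: e1 e2 e3 e4.
Qed.

Lemma dn_sqr_inj x y : sn J x ^+ 2 = sn J y ^+ 2 -> dn J x = dn J y.
Proof.
move=> e; apply/eqP; rewrite -(eqrXn2 (ltn0Sn 1)) ?ltW ?dn_gt0 //.
by rewrite !dn2 e.
Qed.

(** The norms determine the denominator, s^2 and s1^2, hence d and d1, which are
    positive.  The real and imaginary parts of sn, cn, dn then give s, c1 and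
    the products c c1, s s1, s c s1, c s1 c1; away from the poles s and c1 are
    not both 0, and one can divide. *)
Lemma jacobi_inj_finite z z' : finite_den z != 0 -> finite_den z' != 0 ->
  snC z = snC z' -> cnC z = cnC z' -> dnC z = dnC z' ->
  [/\ s z = s z', c z = c z', s1 z = s1 z' & c1 z = c1 z'].
Proof.
move=> D0 D0' es ec ed.
have eD : finite_den z = finite_den z'.
  have := norm_snC_cnC D0; rewrite es ec norm_snC_cnC // => /(mulfI _) e.
  by apply: invr_inj; rewrite e // pnatr_eq0.
have e1 := norm_snC D0; have e2 := norm_cnC D0; have e3 := norm_dnC D0.
rewrite es norm_snC // -eD in e1; rewrite ec norm_cnC // -eD in e2.
rewrite ed norm_dnC // -eD in e3.
have Di : (finite_den z)^-1 != 0 by rewrite invr_eq0.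
move/(mulIf Di): e1 => e1; move/(mulIf Di): e2 => e2; move/(mulIf Di): e3 => e3.
have eS : s z ^+ 2 = s z' ^+ 2 by lra.
have eT : s1 z ^+ 2 = s1 z' ^+ 2 by lra.
have d_eq : d z = d z' by exact: dn_sqr_inj.
have d1_eq : d1 z = d1 z' by exact: dn_sqr_inj.
have d0 := dn_neq0 (Re z); have d10 := dn_neq0 (Im z).
move: es ec ed; rewrite /snC /cnC /dnC -eD -d_eq -d1_eq.
move=> [/(mulIf Di)/(mulIf d10) s_eq /(mulIf Di) h1].
move=> [/(mulIf Di) h2 /oppr_inj/(mulIf Di) h3].
move=> [/(mulIf Di)/(mulIf d10)/(mulfI d0) c1_eq /oppr_inj/(mulIf Di) h4].
rewrite -s_eq -c1_eq in h1 h2 h3 h4.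
have [c10|c10] := eqVneq (c1 z) 0.
  have s0 : s z != 0.
    apply: contra_neq D0 => s0; rewrite finite_denE.
    have := sn2_dn (Re z); have := cn2_dn (Im z); rewrite s0 c10 !expr0n /=.
    by move=> u1 u2; have -> : d z ^+ 2 = 1; lra.
  have s1_eq : s1 z = s1 z'.
    by move/(mulIf d10): h3; apply: mulfI; rewrite mulf_neq0.
  split=> //; move: h4; rewrite -s1_eq.
  have s10 : s1 z != 0.
    exact: sn_neq0.
  have h20 : (2 : R)^-1 != 0 by rewrite invr_eq0 pnatr_eq0.
  by move=> /(mulIf h20)/(mulIf s10)/(mulfI s0).
have c_eq : c z = c z' by exact: mulIf h2.
split=> //; have [s0|s0] := eqVneq (s z) 0.
  have c0 : c z != 0.
    exact: cn_neq0.
  by move/(mulIf c10): h1; rewrite -c_eq; apply: mulfI; rewrite mulf_neq0.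
by move/(mulIf d10): h3; apply: mulfI; rewrite mulf_neq0.
Qed.

Lemma jacobi_inj_pole z z' : finite_den z = 0 -> finite_den z' = 0 ->
  csC z = csC z' -> dsC z = dsC z' ->
  [/\ s z = s z', c z = c z', s1 z = s1 z' & c1 z = c1 z'].
Proof.
move=> /finite_den_eq0[s0 c0] /finite_den_eq0[s0' c0'].
rewrite /csC /dsC !(pole_den_neq0 _ _) // !divr1 s0 c0 s0' c0'.
have dE : d z = d z' by apply: dn_sqr_inj; rewrite s0 s0'.
rewrite -dE => -[_ /oppr_inj/(mulIf (dn_neq0 _)) e] [/oppr_inj]; rewrite -e.
have d1E : d1 z = d1 z' by apply: dn_sqr_inj; rewrite e.
rewrite -d1E => /(mulIf (dn_neq0 _)) h; split=> //; move: h; apply: mulIf.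
exact: sn_neq0.
Qed.

Lemma dnDp x : dn J (x + period J) = dn J x.
Proof. by apply: dn_sqr_inj; rewrite snDp. Qed.
End ComplexJacobi.

(** * The projective embedding of an elliptic curve *)

Section DiffCoords.
Local Open Scope classical_set_scope.
Local Open Scope complex_scope.
Variable R : realType.
Local Notation C := R[i].
Local Notation V := 'cV[C]_2.

(** Functions on C^2 are differentiated coordinatewise. *)
Lemma coord_is_diff (i : 'I_2) (w : V) :
  is_diff w (fun v : V => v i 0) (fun u => u i 0).
Proof.
pose f : {linear V -> C} := HB.pack (fun v : V => v i 0)
  (GRing.isLinear.Build C V C _ (fun v : V => v i 0)
    (fun a u v => etrans (mxE _ _ _ _) (congr1 (fun x => x + v i 0) (mxE _ _ _ _)))).
have fc : continuous f by exact: coord_continuous.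
apply: DiffDef; first exact: differentiable_coord.
exact: (@diff_lin _ _ _ f w fc).
Qed.

Lemma is_diff_comp_coord (i : 'I_2) (w : V) (f : C -> C) (df : C) :
  is_derive (w i 0) (1 : C) f df ->
  is_diff w (fun v : V => f (v i 0)) (fun u => df * u i 0).
Proof.
move=> [fd <-].
have fdiff : is_diff (w i 0) f (fun u => 'D_1 f (w i 0) * u).
  have fd' : differentiable f (w i 0) by exact/derivable1_diffP.
  apply: DiffDef => //; rewrite deriv1E // derive1E.
  by apply/funext => u; rewrite mulrC.
exact: (@is_diff_comp _ _ _ _ _ _ _ _ _ (coord_is_diff i w) fdiff).
Qed.

Lemma is_diff_mul_coords (w : V) (f g : C -> C) (df dg : C) :
  is_derive (w 0 0) (1 : C) f df -> is_derive (w 1 0) (1 : C) g dg ->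
  is_diff w (fun v : V => f (v 0 0) * g (v 1 0))
    (fun u => f (w 0 0) * (dg * u 1 0) + g (w 1 0) * (df * u 0 0)).
Proof.
move=> hf hg.
exact: (@is_diffM _ _ _ _ _ _ _ (is_diff_comp_coord hf) (is_diff_comp_coord hg)).
Qed.

Lemma differentiable_row n (G : V -> 'rV[C]_n) (w : V) :
  (forall k, differentiable (fun v => G v 0 k) w) -> differentiable G w.
Proof.
move=> dG.
have -> : G = \sum_k (fun v => G v 0 k *: (delta_mx 0 k : 'rV[C]_n)).
  by apply/funext => v; rewrite fct_sumE -row_sum_delta.
apply: differentiable_sum => k.
apply: (@differentiable_comp _ _ _ _ (fun v => G v 0 k)
  (fun a : C => a *: (delta_mx 0 k : 'rV[C]_n))) => //.
Qed.

Lemma diff_row n (G : V -> 'rV[C]_n) (w u : V) k (df : V -> C) :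
  differentiable G w -> is_diff w (fun v => G v 0 k) df ->
  'd G w u 0 k = df u.
Proof.
move=> dG [_ <-].
pose f : {linear 'rV[C]_n -> C} := HB.pack (fun v : 'rV[C]_n => v 0 k)
  (GRing.isLinear.Build C 'rV[C]_n C _ (fun v : 'rV[C]_n => v 0 k)
    (fun a u v => etrans (mxE _ _ _ _) (congr1 (fun x => x + v 0 k) (mxE _ _ _ _)))).
have fc : continuous f by exact: coord_continuous.
have -> : (fun v => G v 0 k) = f \o G by [].
rewrite (@diff_comp _ _ _ _ G f w dG (@linear_differentiable _ _ _ f (G w) fc)).
by rewrite (@diff_lin _ _ _ f (G w) fc).
Qed.

End DiffCoords.

Section EllipticEmbedding.
Local Open Scope classical_set_scope.
Local Open Scope complex_scope.
Variables (R : realType) (J : real_jacobi R).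
Local Notation C := R[i].
Implicit Types (z w : C).

Definition finite_row z : 'rV[C]_4 := \row_j [:: snC J z; cnC J z; dnC J z; 1]`_j.
Definition pole_row z : 'rV[C]_4 := \row_j [:: 1; csC J z; dsC J z; nsC J z]`_j.
(** The homogeneous coordinates (sn : cn : dn : 1), which at the poles become
    (1 : cs : ds : ns). *)
Definition elliptic z := if finite_den J z == 0 then pole_row z else finite_row z.

Definition ord4_0 : 'I_4 := inord 0.
Definition ord4_1 : 'I_4 := inord 1.
Definition ord4_2 : 'I_4 := inord 2.
Definition ord4_3 : 'I_4 := inord 3.

Lemma ord4P (P : 'I_4 -> Prop) : P ord4_0 -> P ord4_1 -> P ord4_2 -> P ord4_3 -> forall j, P j.
Proof.
move=> p0 p1 p2 p3 [[|[|[|[|//]]]] h].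
- by move: p0; congr P; apply: val_inj; rewrite /= inordK.
- by move: p1; congr P; apply: val_inj; rewrite /= inordK.
- by move: p2; congr P; apply: val_inj; rewrite /= inordK.
- by move: p3; congr P; apply: val_inj; rewrite /= inordK.
Qed.

Lemma finite_pole_row z : finite_den J z != 0 -> pole_den J z != 0 ->
  finite_row z = snC J z *: pole_row z.
Proof.
move=> DA DB; apply/rowP; apply: ord4P; rewrite !mxE !inordK //=.
- by rewrite mulr1.
- by rewrite snC_csC.
- by rewrite snC_dsC.
- by rewrite snC_nsC.
Qed.

(** The relations sn^2 + cn^2 = 1 and sn^2 + 2 dn^2 = 2 prevent any two of sn,
    cn, dn from vanishing together, so their derivatives do not all vanish. *)
Lemma finite_products_neq0 (a b e : C) :
  a ^+ 2 + b ^+ 2 = 1 -> a ^+ 2 + (e ^+ 2 + e ^+ 2) = 1 + 1 ->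
  ~ [/\ a * b = 0, a * e = 0 & b * e = 0].
Proof.
have n1 : (1 : C) != 0 := oner_neq0 _.
move=> h1 h2 [/eqP]; rewrite mulf_eq0 => /orP[]/eqP h.
  move=> _ /eqP; rewrite mulf_eq0 => /orP[]/eqP h'; move: h1 h2; rewrite h h'.
    by move=> /eqP; rewrite expr0n /= addr0 eq_sym oner_eq0.
  move=> _ /eqP; rewrite expr0n /= !addr0 eq_sym -(natrD _ 1 1) pnatr_eq0 //.
move=> /eqP; rewrite mulf_eq0 => /orP[]/eqP h' _; move: h1 h2; rewrite h h' expr0n /=.
  by move=> /eqP; rewrite addr0 eq_sym oner_eq0.
rewrite !addr0 => -> /eqP; rewrite -subr_eq0 opprD addrA subrr sub0r oppr_eq0.
by rewrite oner_eq0.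
Qed.

(** The same for ns, cs, ds, with cs^2 + 1 = ns^2 and 2 ds^2 + 1 = 2 ns^2. *)
Lemma pole_products_neq0 (a b e : C) :
  b ^+ 2 + 1 = a ^+ 2 -> e ^+ 2 + e ^+ 2 + 1 = a ^+ 2 + a ^+ 2 ->
  ~ [/\ a * b = 0, a * e = 0 & b * e = 0].
Proof.
move=> h1 h2 [/eqP]; rewrite mulf_eq0 => /orP[]/eqP h.
  move=> _ /eqP; rewrite mulf_eq0 => /orP[]/eqP h'; move: h1 h2; rewrite h h'.
    by move=> /eqP; rewrite expr0n /= add0r oner_eq0.
  by move=> _ /eqP; rewrite expr0n /= !add0r oner_eq0.
move=> /eqP; rewrite mulf_eq0 => /orP[]/eqP h' _; move: h1 h2; rewrite h h' expr0n /=.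
  by move=> /eqP; rewrite add0r oner_eq0.
rewrite !add0r => <- /eqP; rewrite -subr_eq0 opprD addrA subrr sub0r oppr_eq0.
by rewrite oner_eq0.
Qed.

(** Near each point the embedding has a holomorphic lift F with one coordinate
    constantly 1.  For such a lift the immersion condition means that dF is
    nonzero, for dF has a zero where F has the coordinate 1. *)
Lemma elliptic_chart z : exists (F : C -> 'rV[C]_4) (dF : 'rV[C]_4) (k : 'I_4),
  [/\ dF != 0, F z 0 k = 1, dF 0 k = 0,
      forall j, is_derive z (1 : C) (fun w => F w 0 j) (dF 0 j) &
      \forall w \near z,
        [/\ F w != 0, exists2 a, a != 0 & elliptic w = a *: F w &
            forall j, exists l, is_derive w (1 : C) (fun w => F w 0 j) l]].
Proof.
have [DA|DA] := eqVneq (finite_den J z) 0.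
  have DB : pole_den J z != 0.
    by have [s0 c0] := finite_den_eq0 DA; rewrite pole_den_neq0 ?oner_eq0.
  have dB w j : pole_den J w != 0 -> is_derive w (1 : C) (fun w => pole_row w 0 j)
      ((\row_j [:: 0; - (nsC J w * dsC J w); - (nsC J w * csC J w);
        - (csC J w * dsC J w)]`_j : 'rV[C]_4) 0 j).
    move=> D; rewrite mxE (_ : (fun w => pole_row w 0 j) =
      fun w => [:: 1; csC J w; dsC J w; nsC J w]`_j); last first.
      by apply/funext => u; rewrite mxE.
    move: j; apply: ord4P; rewrite inordK //=.
    - exact: is_derive_cst.
    - exact: is_derive_csC.
    - exact: is_derive_dsC.
    - exact: is_derive_nsC.
  exists pole_row, (\row_j [:: 0; - (nsC J z * dsC J z); - (nsC J z * csC J z);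
        - (csC J z * dsC J z)]`_j), ord4_0; split.
  - apply/eqP => /rowP h; have := h ord4_1; have := h ord4_2; have := h ord4_3.
    rewrite !mxE !inordK //= => /eqP; rewrite oppr_eq0 => /eqP h1 /eqP.
    rewrite oppr_eq0 => /eqP h2 /eqP; rewrite oppr_eq0 => /eqP h3.
    by apply: (pole_products_neq0 (csC2D1 DB) (dsC2D1 DB)).
  - by rewrite mxE inordK.
  - by rewrite mxE inordK.
  - by move=> j; exact: dB.
  have nB := pole_den_near DB.
  apply: filterS nB => w DBw; split.
  - by apply/eqP => /rowP/(_ ord4_0)/eqP; rewrite !mxE inordK //= oner_eq0.
  - rewrite /elliptic; case: eqP => [_|/eqP DAw].
      by exists 1; rewrite ?oner_eq0 ?scale1r.
    exists (snC J w); last exact: finite_pole_row.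
    by apply: contra_eq_neq (snC_nsC DAw DBw) => ->; rewrite mul0r eq_sym oner_eq0.
  - by move=> j; eexists; exact: dB.
have dA w j : finite_den J w != 0 -> is_derive w (1 : C) (fun w => finite_row w 0 j)
    ((\row_j [:: cnC J w * dnC J w; - (snC J w * dnC J w);
      - (snC J w * cnC J w / 2%:C); 0]`_j : 'rV[C]_4) 0 j).
  move=> D; rewrite mxE (_ : (fun w => finite_row w 0 j) =
    fun w => [:: snC J w; cnC J w; dnC J w; 1]`_j); last first.
    by apply/funext => u; rewrite mxE.
  move: j; apply: ord4P; rewrite inordK //=.
  - exact: is_derive_snC.
  - exact: is_derive_cnC.
  - exact: is_derive_dnC.
  - exact: is_derive_cst.
exists finite_row, (\row_j [:: cnC J z * dnC J z; - (snC J z * dnC J z);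
      - (snC J z * cnC J z / 2%:C); 0]`_j), ord4_3; split.
- apply/eqP => /rowP h; have := h ord4_2; have := h ord4_1; have := h ord4_0.
  rewrite !mxE !inordK //= => h1 /eqP.
  rewrite oppr_eq0 => /eqP h2 /eqP.
  rewrite oppr_eq0 mulf_eq0 invr_eq0 -(rmorph0 (real_complex R)).
  rewrite (inj_eq (@complexI _)) pnatr_eq0 orbF => /eqP h3.
  by apply: (finite_products_neq0 (snC2DcnC2 DA) (snC2DdnC2 DA)).
- by rewrite mxE inordK.
- by rewrite mxE inordK.
- by move=> j; exact: dA.
have nA := finite_den_near DA.
apply: filterS nA => w DAw; split.
- by apply/eqP => /rowP/(_ ord4_3)/eqP; rewrite !mxE inordK //= oner_eq0.
- by exists 1; rewrite ?oner_eq0 ?scale1r /elliptic ?(negbTE DAw).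
- by move=> j; eexists; exact: dA.
Qed.

Lemma ellipticDp z (m n : int) :
  elliptic (z + ((period J *~ m) +i* (period J *~ n))) = elliptic z.
Proof.
have per (f : R -> R) : (forall x, f (x + period J) = f x) ->
    forall (x : R) (m : int), f (x + period J *~ m) = f x.
  move=> fp x; have fpn k y : f (y + period J *+ k) = f y.
    elim: k y => [|k IH] y; first by rewrite addr0.
    by rewrite mulrSr addrA fp IH.
  case=> k; first exact: fpn.
  by rewrite NegzE mulrNz -pmulrn -[in RHS](subrK (period J *+ k.+1) x) fpn.
have ps := per _ (snDp J); have pc := per _ (cnDp J); have pd := per _ (dnDp J).
rewrite /elliptic /finite_row /pole_row /snC /cnC /dnC /nsC /csC /dsC /finite_den /pole_den.
by case: z => x y /=; rewrite !(ps, pc, pd).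
Qed.

(** The last coordinate vanishes exactly at the poles, so proportional vectors
    belong to the same chart, and there the factor is 1. *)
Lemma elliptic_inj z z' (a : C) : elliptic z = a *: elliptic z' ->
  exists m n : int, z - z' = (period J *~ m) +i* (period J *~ n).
Proof.
move=> e.
suff [es ec es1 ec1] : [/\ sn J (Re z) = sn J (Re z'), cn J (Re z) = cn J (Re z'),
    sn J (Im z) = sn J (Im z') & cn J (Im z) = cn J (Im z')].
  have [m em] := sn_cn_inj es ec; have [n en] := sn_cn_inj es1 ec1.
  by exists m, n; rewrite -em -en; case: z z' {e es ec es1 ec1 em en} => ? ? [? ?].
have nsC0 w : finite_den J w = 0 -> nsC J w = 0.
  by move=> /finite_den_eq0[s0 c0]; rewrite /nsC s0 c0 !mul0r mulr0 !mul0r oppr0.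
move: e; rewrite /elliptic; case: eqP => [D|/eqP D]; case: eqP => [D'|/eqP D'] /rowP e;
  have e0 := e ord4_0; have e1 := e ord4_1; have e2 := e ord4_2; have e3 := e ord4_3;
  rewrite !mxE !inordK //= in e0 e1 e2 e3.
- by rewrite mulr1 in e0; rewrite -e0 !mul1r in e1 e2; exact: jacobi_inj_pole.
- move: e3; rewrite nsC0 // mulr1 => a0; move: e0; rewrite -a0 mul0r => /eqP.
  by rewrite oner_eq0.
- by move: e3; rewrite nsC0 // mulr0 => /eqP; rewrite oner_eq0.
- by rewrite mulr1 in e3; rewrite -e3 !mul1r in e0 e1 e2; exact: jacobi_inj_finite.
Qed.

Lemma elliptic_neq0 z : elliptic z != 0.
Proof.
rewrite /elliptic; case: ifP => _.
  by apply/eqP => /rowP/(_ ord4_0)/eqP; rewrite !mxE inordK //= oner_eq0.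
by apply/eqP => /rowP/(_ ord4_3)/eqP; rewrite !mxE inordK //= oner_eq0.
Qed.

End EllipticEmbedding.

(** * The square of an elliptic curve is projective *)

Section TorusProj.
Local Open Scope classical_set_scope.
Local Open Scope complex_scope.
Variables (R : realType) (X : complex_torus R).

Lemma torus_proj_repr (p : X) : torus_proj X (repr p) = p.
Proof. exact: reprK. Qed.

Lemma lattice_repr v : lattice X (repr (torus_proj X v) - v).
Proof. by apply/torus_projE; rewrite torus_proj_repr. Qed.
End TorusProj.

Section SquareTorus.
Local Open Scope classical_set_scope.
Local Open Scope complex_scope.
Variables (R : realType) (J : real_jacobi R).
Local Notation C := R[i].
Local Notation V := 'cV[C]_2.
Local Notation om := (period J).
Local Notation elliptic := (elliptic J).

Definition vec2 (x y : C) : V := \col_k [:: x; y]`_k.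

Definition square_basis (i : 'I_4) : V :=
  [:: vec2 om%:C 0; vec2 (0 +i* om) 0; vec2 0 om%:C; vec2 0 (0 +i* om)]`_i.

Lemma sum_ord4 (U : zmodType) (F : 'I_4 -> U) :
  \sum_i F i = F ord4_0 + F ord4_1 + F ord4_2 + F ord4_3.
Proof.
rewrite !big_ord_recl big_ord0 addr0 !addrA.
by congr (F _ + F _ + F _ + F _); apply: val_inj; rewrite /= inordK.
Qed.

Lemma vec2D x y x' y' : vec2 x y + vec2 x' y' = vec2 (x + x') (y + y').
Proof. by apply/colP => -[[|[|//]] h]; rewrite !mxE. Qed.

Lemma vec2Z a x y : a *: vec2 x y = vec2 (a * x) (a * y).
Proof. by apply/colP => -[[|[|//]] h]; rewrite !mxE. Qed.

Lemma vec2E0 x y : vec2 x y 0 0 = x. Proof. by rewrite mxE. Qed.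
Lemma vec2E1 x y : vec2 x y 1 0 = y. Proof. by rewrite mxE. Qed.

Lemma vec2_eta (v : V) : v = vec2 (v 0 0) (v 1 0).
Proof.
by apply/colP => -[[|[|//]] h]; rewrite mxE /=; congr (v _ 0); apply: val_inj.
Qed.

Lemma square_basis_comb (a : 'I_4 -> R) :
  \sum_i (a i)%:C *: square_basis i =
  vec2 ((a ord4_0 * om) +i* (a ord4_1 * om)) ((a ord4_2 * om) +i* (a ord4_3 * om)).
Proof.
have cE (x y : R) : x%:C * om%:C + y%:C * (0 +i* om) = (x * om) +i* (y * om) :> C.
  by apply/eqP; rewrite eq_complex /=; apply/andP; split; apply/eqP; ring.
have b0 : square_basis ord4_0 = vec2 om%:C 0 by rewrite /square_basis inordK.
have b1 : square_basis ord4_1 = vec2 (0 +i* om) 0 by rewrite /square_basis inordK.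
have b2 : square_basis ord4_2 = vec2 0 om%:C by rewrite /square_basis inordK.
have b3 : square_basis ord4_3 = vec2 0 (0 +i* om) by rewrite /square_basis inordK.
rewrite sum_ord4 b0 b1 b2 b3.
by rewrite !vec2Z !vec2D !mulr0 !addr0 !add0r !cE.
Qed.

Lemma square_basis_free : real_free square_basis.
Proof.
move=> a; rewrite square_basis_comb => e.
have o0 : om != 0 by rewrite gt_eqF ?period_gt0.
have := congr1 (fun v : V => v 0 0) e; have := congr1 (fun v : V => v 1 0) e.
rewrite vec2E0 vec2E1 !mxE => -[/eqP h2 /eqP h3] [/eqP h0 /eqP h1].
move: h0 h1 h2 h3; rewrite !mulf_eq0 !(negbTE o0) !orbF.
by move=> /eqP ? /eqP ? /eqP ? /eqP ?; exact: ord4P.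
Qed.

Definition square_torus : complex_torus R :=
  ComplexTorus (ex_intro2 _ _ square_basis square_basis_free erefl).

Lemma square_latticeP (v : V) : lattice square_torus v <->
  exists m0 n0 m1 n1 : int,
    v 0 0 = (om *~ m0) +i* (om *~ n0) /\ v 1 0 = (om *~ m1) +i* (om *~ n1).
Proof.
have key (m : 'I_4 -> int) :
    (\sum_i square_basis i *~ m i) = vec2 ((om *~ m ord4_0) +i* (om *~ m ord4_1))
      ((om *~ m ord4_2) +i* (om *~ m ord4_3)).
  rewrite -!(mulrzl om) -(square_basis_comb (fun i => (m i)%:~R)).
  by apply: eq_bigr => i _; rewrite -scaler_int rmorph_int.
split=> [[m ->]|[m0 [n0 [m1 [n1 [e0 e1]]]]]].
  by rewrite key vec2E0 vec2E1; exists (m ord4_0), (m ord4_1), (m ord4_2), (m ord4_3).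
exists (fun i => [:: m0; n0; m1; n1]`_i); rewrite key !inordK //=.
by rewrite -e0 -e1 -vec2_eta.
Qed.

(** The Segre map P^3 x P^3 -> P^15. *)
Definition outer (a b : 'rV[C]_4) : 'rV[C]_16 :=
  \row_k (a 0 (inord (k %/ 4)) * b 0 (inord (k %% 4))).

Definition segre_index (i j : 'I_4) : 'I_16 := inord (i * 4 + j).

Lemma outerE a b i j : outer a b 0 (segre_index i j) = a 0 i * b 0 j.
Proof.
have ij : (i * 4 + j < 16)%N by case: i j => [i hi] [j hj] /=; lia.
rewrite mxE /segre_index inordK // divnMDl // modnMDl.
by rewrite divn_small // modn_small // addn0 !inord_val.
Qed.

Definition segre (v : V) := outer (elliptic (v 0 0)) (elliptic (v 1 0)).

Lemma segre_lattice u v : lattice square_torus (u - v) -> segre u = segre v.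
Proof.
move=> /square_latticeP[m0 [n0 [m1 [n1 [e0 e1]]]]].
rewrite !mxE in e0 e1; rewrite /segre.
have -> : u 0 0 = v 0 0 + (u 0 0 - v 0 0) by rewrite addrC subrK.
have -> : u 1 0 = v 1 0 + (u 1 0 - v 1 0) by rewrite addrC subrK.
by rewrite e0 e1 !ellipticDp.
Qed.

Lemma outer_parallel (a b a' b' : 'rV[C]_4) c : b != 0 ->
  outer a b = c *: outer a' b' -> exists k, a = k *: a'.
Proof.
move=> /rV0Pn[j bj] /rowP e; exists (c * b' 0 j / b 0 j); apply/rowP => i.
have := e (segre_index i j); rewrite outerE mxE outerE mxE => h.
by apply: (mulIf bj); rewrite h; field.
Qed.

Lemma outer_parallelr (a b a' b' : 'rV[C]_4) c : a != 0 ->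
  outer a b = c *: outer a' b' -> exists k, b = k *: b'.
Proof.
move=> /rV0Pn[i ai] /rowP e; exists (c * a' 0 i / a 0 i); apply/rowP => j.
have := e (segre_index i j); rewrite outerE mxE outerE mxE => h.
by apply: (mulfI ai); rewrite h; field.
Qed.

Lemma line_scale N (z : 'rV[C]_N.+1) a : a != 0 -> line (a *: z) = line z.
Proof.
move=> a0; apply/seteqP; split=> _ [c _ <-].
  by exists (c * a); rewrite ?scalerA.
by exists (c / a) => //; rewrite scalerA divfK.
Qed.

Lemma line_id N (z : 'rV[C]_N.+1) : line z z.
Proof. by exists 1; rewrite ?scale1r. Qed.

Lemma near_coord (v : V) (i : 'I_2) (P : C -> Prop) :
  (\forall z \near v i 0, P z) -> \forall w \near v, P ((w : V) i 0).
Proof. exact: (@coord_continuous _ _ _ i 0 v). Qed.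

(** For local lifts F0 and F1 with the constant coordinates k0 and k1, the
    (k0, k1) coordinate of their product is constant, so a derivative lying in
    the line of the lift is 0.  Its (i, k1) coordinates are those of the
    derivative of F0, and its (k0, j) coordinates those of the derivative
    of F1. *)
Lemma square_torus_projective : projective square_torus.
Proof.
pose phi (p : square_torus) : set 'rV[C]_16 := line (segre (repr p)).
have phiE w : phi (torus_proj square_torus w) = line (segre w).
  by rewrite /phi (segre_lattice (lattice_repr _ _)).
exists 15%N, phi; split.
  move=> p q pq.
  have : phi q (segre (repr p)) by rewrite -pq; exact: line_id.
  move=> [c _ /esym e].
  have [k0 /elliptic_inj[m0 [n0 h0]]] := outer_parallel (elliptic_neq0 J _) e.
  have [k1 /elliptic_inj[m1 [n1 h1]]] := outer_parallelr (elliptic_neq0 J _) e.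
  rewrite -(torus_proj_repr p) -(torus_proj_repr q); apply/torus_projE.
  by apply/square_latticeP; exists m0, n0, m1, n1; rewrite !mxE.
move=> v.
have [F0 [dF0 [k0 [dF00 F01 dF01 D0 n0]]]] := elliptic_chart J (v 0 0).
have [F1 [dF1 [k1 [dF10 F11 dF11 D1 n1]]]] := elliptic_chart J (v 1 0).
pose F (w : V) : 'rV[C]_16 := outer (F0 (w 0 0)) (F1 (w 1 0)).
have FE (w : V) i j : F w 0 (segre_index i j) = F0 (w 0 0) 0 i * F1 (w 1 0) 0 j.
  exact: outerE.
have nF : \forall w \near v, [/\ differentiable F w, F w != 0 &
    phi (torus_proj square_torus w) = line (F w)].
  apply: filterS2 (near_coord n0) (near_coord n1).
  move=> w [F0n [a0 a00 e0] d0] [F1n [a1 a10 e1] d1].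
  split.
  - apply: differentiable_row => k; set i : 'I_4 := inord (k %/ 4).
    set j : 'I_4 := inord (k %% 4).
    have -> : (fun v => F v 0 k) = fun v => F0 (v 0 0) 0 i * F1 (v 1 0) 0 j.
      by apply/funext => u; rewrite mxE.
    have [l0 h0] := d0 i; have [l1 h1] := d1 j.
    by have [] := is_diff_mul_coords h0 h1.
  - move: F0n F1n => /rV0Pn[i hi] /rV0Pn[j hj]; apply/rV0Pn.
    by exists (segre_index i j); rewrite FE mulf_neq0.
  - rewrite phiE -[RHS](@line_scale _ _ (a0 * a1)) ?mulf_neq0 //; congr line.
    by apply/rowP => k; rewrite /segre /F !mxE e0 e1 !mxE; ring.
exists F; split=> // u [c _ e].
have [dFv _ _] := nbhs_singleton nF.
have DFE i j : 'd F v u 0 (segre_index i j) =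
    F0 (v 0 0) 0 i * (dF1 0 j * u 1 0) + F1 (v 1 0) 0 j * (dF0 0 i * u 0 0).
  apply: (@diff_row _ _ F v u _ (fun u => F0 (v 0 0) 0 i * (dF1 0 j * u 1 0) +
    F1 (v 1 0) 0 j * (dF0 0 i * u 0 0)) dFv).
  have -> : (fun v => F v 0 (segre_index i j)) = fun v => F0 (v 0 0) 0 i * F1 (v 1 0) 0 j.
    by apply/funext => w; rewrite FE.
  exact: is_diff_mul_coords (D0 i) (D1 j).
have eij i j : c * (F0 (v 0 0) 0 i * F1 (v 1 0) 0 j) =
    F0 (v 0 0) 0 i * (dF1 0 j * u 1 0) + F1 (v 1 0) 0 j * (dF0 0 i * u 0 0).
  by rewrite -DFE -e mxE FE.
have c0 : c = 0.
  have := eij k0 k1; rewrite F01 F11 dF01 dF11.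
  by rewrite !(mul0r, mulr0, mulr1, addr0).
have u0 : u 0 0 = 0.
  move/rV0Pn: dF00 => [i hi]; have /eqP := eij i k1.
  rewrite c0 F11 dF11 !(mul0r, mulr0, add0r, mul1r) eq_sym mulf_eq0 (negbTE hi).
  by move=> /eqP.
have u1 : u 1 0 = 0.
  move/rV0Pn: dF10 => [j hj]; have /eqP := eij k0 j.
  rewrite c0 F01 dF01 !(mul0r, mulr0, addr0, mul1r) eq_sym mulf_eq0 (negbTE hj).
  by move=> /eqP.
apply/matrixP => k l; rewrite (ord1 l) mxE.
by case: k => [[|[|//]]] h; [rewrite -[RHS]u0|rewrite -[RHS]u1];
  congr (u _ 0); apply: val_inj.
Qed.
End SquareTorus.

(** * Diagonal endomorphisms of the square *)

Section Endomorphism.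
Local Open Scope classical_set_scope.
Local Open Scope complex_scope.
Variables (R : realType) (X : complex_torus R).
Local Notation C := R[i].
Local Notation V := 'cV[C]_2.
Variable M : 'M[C]_2.
Hypothesis M_lattice : forall v, lattice X v -> lattice X (M *m v).

Definition induced_fun (p : X) : X := torus_proj X (M *m repr p).

Lemma induced_analytic_rep : is_analytic_rep induced_fun M.
Proof.
move=> v; apply/torus_projE; rewrite -mulmxBr; apply: M_lattice.
exact: lattice_repr.
Qed.

Lemma induced_zmod_morphism : zmod_morphism induced_fun.
Proof.
move=> p q; rewrite -(torus_proj_repr p) -(torus_proj_repr q) -torus_projB.
by rewrite !induced_analytic_rep mulmxBr torus_projB.
Qed.

Definition induced_endo : {additive X -> X} :=
  HB.pack induced_fun (GRing.isZmodMorphism.Build X X induced_fun induced_zmod_morphism).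

Lemma induced_holomorphic : holomorphic induced_endo.
Proof.
move=> v; exists (fun w => M *m w); near=> w; split; last exact: induced_analytic_rep.
have -> : mulmx M = \sum_j (fun w : V => w j 0 *: col j M).
  apply/funext => u; rewrite fct_sumE; apply/colP => k; rewrite mxE summxE.
  by apply: eq_bigr => j _; rewrite !mxE mulrC.
apply: differentiable_sum => j.
apply: (@differentiable_comp _ _ _ _ (fun u : V => u j 0) (fun a : C => a *: col j M)) => //.
exact: differentiable_coord.
Unshelve. all: by end_near. Qed.

Lemma induced_eigenvalues l1 l2 :
  char_poly M = ('X - l1%:P) * ('X - l2%:P) -> eigenvalues induced_endo l1 l2.
Proof.
move=> e; rewrite /eigenvalues -e; congr char_poly; apply/esym.
by apply/(rho_aP _ induced_holomorphic)/induced_analytic_rep.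
Qed.

End Endomorphism.

Section Examples.
Local Open Scope classical_set_scope.
Local Open Scope complex_scope.
Variables (R : realType) (J : real_jacobi R).
Local Notation C := R[i].
Local Notation V := 'cV[C]_2.
Local Notation X := (square_torus J).
Local Notation om := (period J).

Definition int_diag (a b : int) : 'M[C]_2 := diag_mx (\row_j (vec2 a%:~R b%:~R : V) j 0).

Lemma int_diag_vec2 a b x y : int_diag a b *m vec2 x y = vec2 (a%:~R * x) (b%:~R * y).
Proof.
rewrite mul_diag_mx; apply/colP => k; rewrite !mxE.
by case: k => [[|[|//]]].
Qed.

Lemma int_diag_lattice a b v : lattice X v -> lattice X (int_diag a b *m v).
Proof.
move=> /square_latticeP[m0 [n0 [m1 [n1 [e0 e1]]]]]; apply/square_latticeP.
exists (a * m0), (a * n0), (b * m1), (b * n1).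
rewrite [v]vec2_eta int_diag_vec2 vec2E0 vec2E1 e0 e1.
have CE (n x y : int) : n%:~R * ((om *~ x) +i* (om *~ y)) =
    (om *~ (n * x)) +i* (om *~ (n * y)) :> C.
  rewrite -(rmorph_int (real_complex R)) -!(mulrzl om).
  by apply/eqP; rewrite eq_complex /=; apply/andP; split; apply/eqP; rewrite rmorphM /=; ring.
by rewrite !CE.
Qed.

Definition diag_endo a b : {additive X -> X} := induced_endo (@int_diag_lattice a b).

Lemma diag_endo_holomorphic a b : holomorphic (diag_endo a b).
Proof. exact: induced_holomorphic. Qed.

Lemma diag_endo_eigenvalues a b : eigenvalues (diag_endo a b) a%:~R b%:~R.
Proof.
apply: induced_eigenvalues; rewrite char_poly_trig ?diag_mx_is_trig //.
by rewrite !big_ord_recl big_ord0 mulr1 !mxE.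
Qed.

(** The point with first coordinate omega / (2 a) is mapped to a point of
    order 2. *)
Lemma diag_endo_neq0 a b : a != 0 -> exists x : X, diag_endo a b x != 0.
Proof.
move=> a0; pose h : R := om / 2.
have aC : a%:~R != 0 :> C by rewrite intr_eq0.
exists (torus_proj X (vec2 ((a%:~R)^-1 * h%:C) 0)).
have -> : diag_endo a b (torus_proj X (vec2 ((a%:~R)^-1 * h%:C) 0)) =
    torus_proj X (vec2 h%:C 0).
  rewrite [LHS](induced_analytic_rep (@int_diag_lattice a b)) int_diag_vec2.
  by rewrite mulr0 mulVKf.
apply/eqP => e0; have : lattice X (vec2 h%:C 0 - 0).
  apply/torus_projE; rewrite e0; apply/esym; exact: raddf0.
rewrite subr0 => /square_latticeP[m [n [m1 [n1 []]]]]; rewrite vec2E0 => -[hm _] _.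
have om0 : om != 0 by rewrite gt_eqF ?period_gt0.
have : (1 : int)%:~R = (m * 2)%:~R :> R.
  apply: (mulfI om0); rewrite rmorphM /= mulrA [om * m%:~R]mulrzr -hm /h mulr1.
  by rewrite divfK ?pnatr_eq0.
by move/intr_inj; lia.
Qed.

Lemma modulus_int (a : int) : modulus (a%:~R : C) = `|a%:~R|.
Proof.
rewrite -(rmorph_int (real_complex R)) /modulus /rnorm /= expr0n /= addr0.
exact: sqrtr_sqr.
Qed.

Lemma diag_endo_nfix a b n : (nfix (iter n (diag_endo a b)))%:R =
  rnorm ((a%:~R : C) ^+ n - 1) * rnorm ((b%:~R : C) ^+ n - 1).
Proof. exact: (nfix_iter n (@diag_endo_holomorphic a b) (diag_endo_eigenvalues a b)). Qed.

Lemma example_growth : exp_growth R (fun n => nfix (iter n (diag_endo 2 2))).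
Proof.
apply: (hyperbolic_exp_growth (diag_endo_nfix 2 2)); rewrite modulus_int ger0_norm //.
  by rewrite ltr1n.
by rewrite gt_eqF // ltr1n.
Qed.

Lemma example_periodic : periodic_sequence (fun n => nfix (iter n (diag_endo 1 1))).
Proof.
have u0 := fun n => fixed_eigenvalue_zero (diag_endo_nfix 1 1) n erefl.
by exists 1%N => // n _; rewrite !u0.
Qed.

Lemma example_off_multiples :
  exp_growth_off_multiples R (fun n => nfix (iter n (diag_endo (-1) 2))).
Proof.
apply: (root_of_unity_off_multiples (diag_endo_nfix (-1) 2)).
- by rewrite -[12%N]/(2 * 6)%N exprM sqrrN !expr1n.
- by rewrite rmorphN1 eq_sym -addr_eq0 -(natrD _ 1 1) pnatr_eq0.
- by rewrite modulus_int ger0_norm // ltr1n.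
Qed.
End Examples.

(** * The theorem *)

(* In the periodic case, eigenvalues 1 and l with 1 < `|l| must be allowed:
   for (x, y) |-> (x, 2 y) on E * E, the count is 0 for every n. *)
Theorem theorem1 (R : realType) :
  (forall (X : complex_torus R) (f : {additive X -> X}),
     holomorphic f -> (exists x : X, f x != 0) ->
     let u := fun n : nat => nfix (iter n f) in
     [\/ exp_growth R u, periodic_sequence u | exp_growth_off_multiples R u] /\
     (forall l1 l2 : R[i], eigenvalues f l1 l2 ->
        [/\ exp_growth R u -> `|l1| != 1 /\ `|l2| != 1,
            periodic_sequence u ->
              (exists2 k : nat, k \in [:: 1; 2; 3; 4; 5; 6; 8; 10; 12]%N &
                 forall l : R[i], l \in [:: l1; l2] -> l != 0 ->
                   k.-unity_root l) \/
              (l1 = 1 /\ 1 < `|l2|) \/ (l2 = 1 /\ 1 < `|l1|) &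
            exp_growth_off_multiples R u ->
              (1 < `|l1| /\ is_root_of_unity l2) \/
              (1 < `|l2| /\ is_root_of_unity l1)])) /\
  [/\ exists (X : complex_torus R) (f : {additive X -> X}),
        [/\ projective X, holomorphic f, exists x : X, f x != 0 &
            exp_growth R (fun n : nat => nfix (iter n f))],
      exists (X : complex_torus R) (f : {additive X -> X}),
        [/\ projective X, holomorphic f, exists x : X, f x != 0 &
            periodic_sequence (fun n : nat => nfix (iter n f))] &
      exists (X : complex_torus R) (f : {additive X -> X}),
        [/\ projective X, holomorphic f, exists x : X, f x != 0 &
            exp_growth_off_multiples R (fun n : nat => nfix (iter n f))]].
Proof.
split; first by move=> X f hf _; exact: fixed_point_behaviour.
have [J] := real_jacobi_exists R.
have P := square_torus_projective J.
split.
- exists (square_torus J), (diag_endo J 2 2); split=> //.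
  + exact: diag_endo_holomorphic.
  + exact: diag_endo_neq0.
  + exact: example_growth.
- exists (square_torus J), (diag_endo J 1 1); split=> //.
  + exact: diag_endo_holomorphic.
  + exact: diag_endo_neq0.
  + exact: example_periodic.
- exists (square_torus J), (diag_endo J (-1) 2); split=> //.
  + exact: diag_endo_holomorphic.
  + exact: diag_endo_neq0.
  + exact: example_off_multiples.
Qed.
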